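(* Let $\{\mathcal{D}_{p,n}\}_{p,n}$ be an array of data sets, where $\mathcal{D}_{p,n}$ consists of a real $n\times p$ design matrix $X=X_{n\times p}$ and a response vector $y\in\{0,1\}^n$, each with a corresponding prior with parameters $(Q,v)=(Q_{p,n},v_{p,n})$. Suppose that: (C1) for every $p$ and $n$, $Q$ is positive definite; (C2) there exists a constant $\ell<\infty$ such that $\lambda_{\max}(XQ^{-1}X^T)\le\ell$ for all $p$ and $n$. Then there exists a constant $\rho<1$ such that, for all $n$ and $p$, the Albert–Chib chain satisfies $\rho_*(\psi)\le\rho$. The result continues to hold if $\rho_*(\psi)$ is replaced by $\rho_*^{\mathrm{TV}}$.
   Context: Albert–Chib chain for given $(X,y,Q,v)$: $X$ has $i$th row $x_i^T$, $v\in\mathbb{R}^p$, $Q$ is a symmetric $p\times p$ matrix, $\Phi$ is the standard normal cdf, $\Sigma=X^TX+Q$. The posterior density is $\pi(\beta|X,y)\propto\prod_{i=1}^n\Phi(x_i^T\beta)^{y_i}(1-\Phi(x_i^T\beta))^{1-y_i}\exp[-\frac12(\beta-v)^TQ(\beta-v)]$, $\beta\in\mathbb{R}^p$ (automatically proper when $Q$ is positive definite); $\Pi$ is the corresponding probability measure. For $a\in\{0,1\}$, $\mathrm{TN}(\mu,1;a)$ is $\mathrm{N}(\mu,1)$ truncated to $(-\infty,0)$ if $a=0$ and to $(0,\infty)$ if $a=1$. The Markov transition function $K(\beta,\cdot)$ is the law of $\tilde\beta$ obtained by drawing independent $Z_i\sim\mathrm{TN}(x_i^T\beta,1;y_i)$,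 $i=1,\dots,n$, $Z=(Z_1,\dots,Z_n)^T$, then $\tilde\beta\sim\mathrm{N}(\Sigma^{-1}(X^TZ+Qv),\Sigma^{-1})$. $K_\beta^m$ is the $m$-step law from $\beta$. $\psi(\beta,\beta')=[(\beta-\beta')^T\Sigma(\beta-\beta')]^{1/2}$; $\mathrm{W}_\psi(\mu,\nu)$ is the infimum of $\int\psi\,d\upsilon$ over couplings $\upsilon$ of $\mu,\nu$. $\rho_*(\psi)\in[0,1]$ is the infimum of $\rho\in[0,1]$ for which there is $M:\mathbb{R}^p\to[0,\infty)$ with $\mathrm{W}_\psi(K_\beta^m,\Pi)\le M(\beta)\rho^m$ for all $m\ge1$, $\beta\in\mathbb{R}^p$ (equal to $1$ if there is no such $\rho$). $\rho_*^{\mathrm{TV}}$ is defined in the same way with the total variation distance (supremum of discrepancy over measurable sets) in place of $\mathrm{W}_\psi$. $\lambda_{\max}$ is the largest eigenvalue. *)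

(* Defs.v *)
From HB Require Import structures.
From mathcomp Require Import all_boot all_order all_algebra.
From mathcomp Require Import all_classical all_reals all_analysis.

Set Implicit Arguments.
Unset Strict Implicit.
Unset Printing Implicit Defensive.
Import Order.TTheory GRing.Theory Num.Theory.
Import numFieldNormedType.Exports.

Local Open Scope classical_set_scope.
Local Open Scope ring_scope.

Section linear_algebra.
Context {R : realType}.

Definition qform p (S : 'M[R]_p) (u : 'cV[R]_p) : R :=
  (u^T *m S *m u) ord0 ord0.

Definition posdef p (Q : 'M[R]_p) : Prop :=
  Q^T = Q /\ forall u : 'cV[R]_p, u != 0 -> 0 < qform Q u.

(* The set of eigenvalues is finite; for a symmetric matrix of positive size it
   is also nonempty, so that the supremum is the largest eigenvalue. *)
Definition lambda_max n (A : 'M[R]_n) : R := sup [set a | eigenvalue A a].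

End linear_algebra.

(* R^p is represented by p.-tuple R, on which the library provides the product
   (= Borel) sigma-algebra; colv is the identification with column vectors. *)
Section measures_on_Rp.
Context {R : realType}.

Definition colv p (b : p.-tuple R) : 'cV[R]_p := \col_i tnth b i.

(* The product measure mu_0 x ... x mu_(n-1). *)
Fixpoint tuple_prod n : ('I_n -> set R -> \bar R) ->
    set (n.-tuple R) -> \bar R :=
  match n with
  | 0 => fun _ => \d_([tuple] : 0.-tuple R)
  | n'.+1 => fun mu =>
      pushforward (mu ord0 \x tuple_prod (fun i => mu (lift ord0 i)))%E
        (fun u : R * n'.-tuple R => [tuple of u.1 :: u.2])
  end.

Definition lebesgue_tuple p : set (p.-tuple R) -> \bar R :=
  tuple_prod (fun _ => lebesgue_measure).

(* The probability measure on R^p whose Lebesgue density is proportional to w,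
   for w >= 0 with positive and finite total integral. *)
Definition density_prob p (w : p.-tuple R -> R) (A : set (p.-tuple R)) :
    \bar R :=
  ((\int[@lebesgue_tuple p]_(b in A) (w b)%:E) *
   ((fine (\int[@lebesgue_tuple p]_b (w b)%:E))^-1)%:E)%E.

(* N(m, C) with mean m and (positive definite) covariance matrix C. *)
Definition multinormal p (m : 'cV[R]_p) (C : 'M[R]_p) :
    set (p.-tuple R) -> \bar R :=
  density_prob (fun b => expR (- (2^-1 * qform (invmx C) (colv b - m)))).

Definition Phi (x : R) : R := fine (normal_prob 0 1 `]-oo, x]).

(* N(mu, 1) conditioned on (0, +oo) if a = true, on (-oo, 0) if a = false. *)
Definition trunc_normal (mu : R) (a : bool) (A : set R) : \bar R :=
  let I : set R := if a then [set x | 0 < x] else [set x | x < 0] in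
  (normal_prob mu 1 (A `&` I) * ((fine (normal_prob mu 1 I))^-1)%:E)%E.

End measures_on_Rp.

Section convergence_rates.
Context {R : realType} {d : measure_display} {T : measurableType d}.
Implicit Types (mu nu : set T -> \bar R).

Definition coupling mu nu (ups : probability (T * T)%type R) : Prop :=
  forall A : set T, measurable A ->
    ups (fst @^-1` A) = mu A /\ ups (snd @^-1` A) = nu A.

Definition wasserstein (c : T -> T -> R) mu nu : \bar R :=
  ereal_inf [set (\int[ups]_u (c u.1 u.2)%:E)%E | ups in coupling mu nu].

Definition tv_dist mu nu : \bar R :=
  ereal_sup [set (`|mu A - nu A|)%E | A in measurable].

Definition step (K : T -> set T -> \bar R) mu (A : set T) : \bar R :=
  (\int[mu]_b K b A)%E.

Definition mstep_law (K : T -> set T -> \bar R) (m : nat) (b : T) :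
    set T -> \bar R :=
  iter m (step K) (\d_b).

Definition geometric_rates (dist : (set T -> \bar R) -> (set T -> \bar R) -> \bar R)
    (K : T -> set T -> \bar R) (Pi : set T -> \bar R) : set R :=
  [set rho | 0 <= rho <= 1 /\
    exists M : T -> R, (forall b, 0 <= M b) /\
      forall (m : nat) (b : T), (1 <= m)%N ->
        (dist (mstep_law K m b) Pi <= (M b * rho ^+ m)%:E)%E].

Definition rho_star (dist : (set T -> \bar R) -> (set T -> \bar R) -> \bar R)
    (K : T -> set T -> \bar R) (Pi : set T -> \bar R) : R :=
  if `[< geometric_rates dist K Pi !=set0 >]
  then inf (geometric_rates dist K Pi) else 1.

End convergence_rates.

Section albert_chib.
Context {R : realType} {p n : nat}.
Variables (X : 'M[R]_(n, p)) (y : n.-tuple bool).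
Variables (Q : 'M[R]_p) (v : 'cV[R]_p).

Definition Sigma : 'M[R]_p := X^T *m X + Q.

(* x_i^T beta *)
Definition linpred (b : p.-tuple R) (i : 'I_n) : R := (X *m colv b) i ord0.

Definition posterior : set (p.-tuple R) -> \bar R :=
  density_prob (fun b =>
    (\prod_(i < n) (Phi (linpred b i) ^+ tnth y i *
                    (1 - Phi (linpred b i)) ^+ (1 - tnth y i)%N)) *
    expR (- (2^-1 * qform Q (colv b - v)))).

Definition albert_chib (b : p.-tuple R) (A : set (p.-tuple R)) : \bar R :=
  (\int[tuple_prod (fun i => trunc_normal (linpred b i) (tnth y i))]_z
     multinormal (invmx Sigma *m (X^T *m colv z + Q *m v)) (invmx Sigma) A)%E.

Definition psi (b b' : p.-tuple R) : R :=
  Num.sqrt (qform Sigma (colv b - colv b')).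

Definition rho_star_psi : R :=
  rho_star (wasserstein psi) albert_chib posterior.

Definition rho_star_TV : R := rho_star tv_dist albert_chib posterior.

End albert_chib.

(* Main.v *)
Require Import Defs.
From HB Require Import structures.
From mathcomp Require Import all_boot all_order all_algebra.
From mathcomp Require Import all_classical all_reals all_analysis.
From mathcomp Require Import measurable_realfun.
From mathcomp Require Import ring lra.

(** Write S for Sigma and u . w for the Euclidean product. One step of the
    chain from b is b' = m(Z) + W, where m(z) = S^-1 (X^T z + Q v), W is a
    centred normal vector with covariance S^-1, and Z_i is a truncated normal
    variable with location mu_i = x_i . b. Writing Z_i as the quantile
    transform q(mu_i, U_i) of a uniform variable turns the chain into the
    iteration of a random map [chain_map], fed with the same independent noise
    (U, W) whatever the starting point.

    This map contracts the distance psi. The quantile q(mu, u) is nondecreasing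
    in mu, because normal densities have monotone likelihood ratios, while
    q(mu, u) - mu is nonincreasing, because it is the quantile of a standard
    normal variable conditioned on a half-line that moves to the left as mu
    grows; hence q is 1-Lipschitz in mu [trunc_quantile_lip]. The remaining
    factors are linear algebra: if the largest eigenvalue of X Q^-1 X^T is at
    most l, then |X u|^2 <= r u^T S u and the S-norm of S^-1 X^T d is at most
    sqrt r |d|, with r = l / (1 + l). Two starting points at distance psi are
    therefore sent to points at distance at most r psi, for every value of the
    noise [chain_map_contract].

    Run two copies of the chain with common noise, one from b and one from the
    posterior, which is invariant [posterior_invariant]: after m steps the mean
    distance is at most r^m times the posterior mean of psi(b, .), and this is
    finite because the posterior density is dominated by the Gaussian prior
    [posterior_psi_lty]. This gives the rate r for the Wasserstein distance.
    For total variation, the last step is smoothing: conditionally on Z and Z'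
    the two chains are normal with the same covariance, and the total variation
    distance of two such laws is at most a constant times the S-distance of
    their means [multinormal_diff_le], so that r is a rate in this case too.
    Since r depends on l only, it serves for all p and n.

    Invariance comes from data augmentation: the density J(b, z) proportional
    to the prior in b times the N(x_i . b, 1) densities of the z_i, restricted
    to the half-lines prescribed by y, has the posterior as marginal in b, the
    truncated normal laws as conditional law of z, and, by completing the
    square, N(m(z), S^-1) as conditional law of b. *)

Set Implicit Arguments.
Unset Strict Implicit.
Unset Printing Implicit Defensive.
Import Order.TTheory GRing.Theory Num.Theory.
Import numFieldNormedType.Exports.

Local Open Scope classical_set_scope.
Local Open Scope ring_scope.

(** * Integrals against set functions and densities *)

Section integral_tools.
Context d (T : measurableType d) (R : realType).
Local Open Scope ereal_scope.
Import HBNNSimple.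

(** An integral depends on the measure only through the sets on which simple
    functions are constant. The iterated laws of a kernel are set functions
    known on measurable sets only, and this is how they are integrated. *)
Lemma eq_integral_on_measurable (m1 m2 : set T -> \bar R) (f : T -> \bar R) :
  (forall A, measurable A -> m1 A = m2 A) ->
  \int[m1]_x f x = \int[m2]_x f x.
Proof.
move=> m12; have sint (h : {nnsfun T >-> R}) : sintegral m1 h = sintegral m2 h.
  by apply: eq_fsbigr => r _; rewrite m12.
rewrite /integral; congr (ereal_sup _ - ereal_sup _); rewrite eqEsubset;
  by split => _ [h hf <-]; exists h.
Qed.

Lemma ge0_integral_density (mu nu : {measure set T -> \bar R}) (w : T -> R)
    (f : T -> \bar R) :
  measurable_fun [set: T] w -> (forall x, 0 <= w x)%R ->
  (forall A, measurable A -> nu A = \int[mu]_(x in A) (w x)%:E) ->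
  measurable_fun [set: T] f -> (forall x, 0 <= f x) ->
  \int[nu]_x f x = \int[mu]_x (f x * (w x)%:E).
Proof.
move=> mw w0 nuE mf f0.
have mwE : measurable_fun [set: T] (EFin \o w) by exact/measurable_EFinP.
have step (h : {nnsfun T >-> R}) :
    \int[nu]_x (h x)%:E = \int[mu]_x ((h x)%:E * (w x)%:E).
  transitivity (\sum_(k \in range h) k%:E * nu (h @^-1` [set k])).
    by rewrite integralT_nnsfun sintegralE.
  under [RHS]eq_integral => x _.
    rewrite fimfunE -fsumEFin// ge0_mule_fsuml; last first.
      by move=> r; exact: nnfun_muleindic_ge0.
    over.
  rewrite ge0_integral_fsum//; last 2 first.
  - move=> r; apply: emeasurable_funM => //.
    by apply/measurable_EFinP/measurable_funM.
  - by move=> r x _; rewrite mule_ge0// ?nnfun_muleindic_ge0// lee_fin.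
  apply: eq_fsbigr => r; rewrite inE => -[t _ <-{r}].
  have mh : measurable (h @^-1` [set h t]) by [].
  under eq_integral do rewrite EFinM -muleA.
  rewrite ge0_integralZl//; last 3 first.
  - apply: emeasurable_funM => //; exact/measurable_EFinP.
  - by move=> x _; rewrite mule_ge0// lee_fin.
  - by rewrite lee_fin.
  congr (_ * _); rewrite nuE// [LHS]integral_mkcond.
  apply: eq_integral => x _; rewrite patchE indicE.
  by case: ifPn => _; rewrite ?mul1e ?mul0e.
(* Both integrals are limits along simple functions increasing to f. *)
pose g := nnsfun_approx measurableT mf.
have gf x : (g n x)%:E @[n --> \oo] --> f x.
  by apply: cvg_nnsfun_approx => // y _.
have ndg x : {homo (fun n => (g n x)) : a b / (a <= b)%N >-> (a <= b)%R}.
  by move=> a b ab; exact/lefP/nd_nnsfun_approx.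
transitivity (limn (fun n => \int[nu]_x (g n x)%:E)).
  rewrite -monotone_convergence//.
  - by apply: eq_integral => x _; apply/esym/cvg_lim => //.
  - by move=> n; exact/measurable_EFinP.
  - by move=> n x _; rewrite lee_fin.
  - by move=> x _ a b ab; rewrite lee_fin ndg.
under eq_fun do rewrite step.
rewrite -monotone_convergence//.
- apply: eq_integral => x _; apply/cvg_lim => //.
  apply: cvgeZr => //; exact: gf.
- by move=> n; apply: emeasurable_funM => //; exact/measurable_EFinP.
- by move=> n x _; rewrite mule_ge0// lee_fin.
- by move=> x _ a b ab; rewrite lee_wpmul2r ?lee_fin// ndg.
Qed.

(** If the integral vanished, so would the function almost everywhere on D. *)
Lemma integral_gt0 (mu : {measure set T -> \bar R}) (D : set T) (f : T -> \bar R) :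
  measurable D -> measurable_fun D f -> (forall x, D x -> 0 < f x) ->
  mu D != 0 -> 0 < \int[mu]_(x in D) f x.
Proof.
move=> mD mf f0 muD; rewrite lt0e integral_ge0 ?andbT; last first.
  by move=> x /f0/ltW.
apply: contra muD => /eqP intf0.
have : ae_eq mu D f (cst 0).
  apply/(ae_eq_integral_abs mu mD mf).
  by rewrite -[RHS]intf0; apply: eq_integral => x; rewrite inE => /f0/ltW/gee0_abs.
move=> aef; apply/eqP/(measure_negligible mD).
apply: negligibleS aef => x Dx /= /(_ Dx) fx0.
by have := f0 _ Dx; rewrite fx0 ltxx.
Qed.

End integral_tools.

(** * Product measures on tuples *)

Section tuple_measure.
Context {R : realType}.
Local Open Scope ereal_scope.
Local Notation sfm := {sigma_finite_measure set R -> \bar R}.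

Let cons_pair n (u : R * n.-tuple R) : n.+1.-tuple R := [tuple of u.1 :: u.2].

Let measurable_cons_pair n : measurable_fun [set: R * n.-tuple R] (@cons_pair n).
Proof. exact: measurable_cons. Qed.

(** Sigma-finiteness passes through the bijection between pairs (x, t) and
    tuples x :: t, and is what allows the induction to form the next product. *)
Let sigma_finite_tuple_prod n (mu : 'I_n -> sfm) :
  exists m : {sigma_finite_measure set (n.-tuple R) -> \bar R},
    (m : set (n.-tuple R) -> \bar R) = tuple_prod (fun i => mu i).
Proof.
elim: n mu => [|n IH] mu; first by exists (\d_([tuple] : 0.-tuple R)).
have [m mE] := IH (fun i => mu (lift ord0 i)).
(* The sets F k x G k that exhaust the product are carried over by this
   inverse of [cons_pair]. *)
pose uncons (t : n.+1.-tuple R) : R * n.-tuple R :=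
  (thead t, [tuple of behead t]).
have muncons : measurable_fun [set: n.+1.-tuple R] uncons.
  apply/measurable_fun_pairP; split; last exact: measurable_behead.
  exact: measurable_tnth.
pose Q0 := [the {measure set (n.+1.-tuple R) -> \bar R} of
  pushforward [the {measure set _ -> \bar R} of mu ord0 \x m]
    (@cons_pair n)].
pose Q := Q0 (@measurable_cons_pair n).
have QE : (Q : set _ -> _) = tuple_prod (fun i => mu i).
  by rewrite /Q/= mE.
have sfQ : sigma_finite setT Q.
  have /sigma_finiteP[F [FT ndF Foo]] := sigma_finiteT (mu ord0).
  have /sigma_finiteP[G [GT ndG Goo]] := sigma_finiteT m.
  exists (fun k => uncons @^-1` (F k `*` G k)).
    apply/esym; rewrite -subTset => t _.
    have [i _ Fi] : (\bigcup_i F i) (uncons t).1 by rewrite -FT.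
    have [j _ Gj] : (\bigcup_i G i) (uncons t).2 by rewrite -GT.
    exists (maxn i j) => //; split.
    - by move: Fi; exact/subsetPset/ndF/leq_maxl.
    - by move: Gj; exact/subsetPset/ndG/leq_maxr.
  move=> k; have [mF muF] := Foo k; have [mG mmG] := Goo k.
  have mFG : measurable (F k `*` G k) by exact: measurableX.
  split; first by rewrite -[X in measurable X]setTI; exact: muncons.
  rewrite /Q/= /pushforward -comp_preimage.
  have -> : uncons \o @cons_pair n = id.
    by apply/funext => -[x t]/=; congr pair; exact/val_inj.
  rewrite preimage_id.
  rewrite [ltLHS]product_measure1E// lte_mul_pinfty// ge0_fin_numE//.
pose isf := Measure_isSigmaFinite.Build _ _ _ Q sfQ.
pose Q' : {sigma_finite_measure set (n.+1.-tuple R) -> \bar R} :=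
  HB.pack (Measure.sort Q) (Measure.class Q) isf.
by exists Q'.
Qed.

(** The product [tuple_prod] restricted to sigma-finite factors, so that it
    carries the structure of a sigma-finite measure. *)
Definition tprod n (mu : 'I_n -> sfm) : set (n.-tuple R) -> \bar R :=
  tuple_prod (fun i => mu i).

Let tprod0 n (mu : 'I_n -> sfm) : tprod mu set0 = 0.
Proof.
by have [m mE] := sigma_finite_tuple_prod mu; rewrite /tprod -mE measure0.
Qed.

Let tprod_ge0 n (mu : 'I_n -> sfm) A : 0 <= tprod mu A.
Proof.
by have [m mE] := sigma_finite_tuple_prod mu; rewrite /tprod -mE.
Qed.

Let tprod_additive n (mu : 'I_n -> sfm) : semi_sigma_additive (tprod mu).
Proof.
have [m mE] := sigma_finite_tuple_prod mu; rewrite /tprod -mE.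
exact: measure_semi_sigma_additive.
Qed.

HB.instance Definition _ n (mu : 'I_n -> sfm) :=
  isMeasure.Build _ _ _ (tprod mu)
    (tprod0 mu) (tprod_ge0 mu) (@tprod_additive n mu).

Let tprod_sigma_finite n (mu : 'I_n -> sfm) : sigma_finite setT (tprod mu).
Proof.
have [m mE] := sigma_finite_tuple_prod mu; rewrite /tprod -mE.
exact: sigma_finiteT.
Qed.

HB.instance Definition _ n (mu : 'I_n -> sfm) :=
  Measure_isSigmaFinite.Build _ _ _ (tprod mu) (@tprod_sigma_finite n mu).

Lemma ge0_integral_tprod0 (mu : 'I_0 -> sfm) (f : 0.-tuple R -> \bar R) :
  (forall t, 0 <= f t) -> \int[tprod mu]_t f t = f [tuple].
Proof.
move=> f0; have mf : measurable_fun [set: 0.-tuple R] f.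
  rewrite (_ : f = cst (f [tuple]))//.
  by apply/funext => t; rewrite tuple0.
by rewrite /tprod/= integral_dirac// diracT mul1e.
Qed.

(** Tonelli for the first coordinate; every integral over a product of n
    factors is computed by induction from this step. *)
Lemma ge0_integral_tprodS n (mu : 'I_n.+1 -> sfm) (f : n.+1.-tuple R -> \bar R) :
  measurable_fun [set: n.+1.-tuple R] f -> (forall t, 0 <= f t) ->
  \int[tprod mu]_t f t =
  \int[mu ord0]_x \int[tprod (fun i => mu (lift ord0 i))]_t f [tuple of x :: t].
Proof.
move=> mf f0.
pose m := [the {sigma_finite_measure set _ -> \bar R} of
  tprod (fun i => mu (lift ord0 i))].
transitivity (\int[pushforward [the {measure set _ -> \bar R} of mu ord0 \x m]
    (@cons_pair n)]_t f t); first by [].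
rewrite ge0_integral_pushforward//=.
rewrite (fubini_tonelli1 (m1 := mu ord0) (m2 := m) (f \o @cons_pair n))//=; last first.
  by apply: measurableT_comp => //; exact: measurable_cons_pair.
exact: measurable_cons_pair.
Qed.

Definition coord_map n (phi : 'I_n -> R -> R) (t : n.-tuple R) : n.-tuple R :=
  [tuple phi i (tnth t i) | i < n].

Lemma measurable_coord_map n (phi : 'I_n -> R -> R) :
  (forall i, measurable_fun [set: R] (phi i)) ->
  measurable_fun [set: n.-tuple R] (coord_map phi).
Proof.
move=> mphi; apply/measurable_fun_tnthP => i.
rewrite (_ : _ \o _ = phi i \o (fun t => tnth t i)).
  by apply: measurableT_comp => //; exact: measurable_tnth.
by apply/funext => t /=; rewrite tnth_mktuple.
Qed.

Lemma coord_map_cons n (phi : 'I_n.+1 -> R -> R) x (t : n.-tuple R) :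
  coord_map phi [tuple of x :: t] =
  [tuple of phi ord0 x :: coord_map (fun i => phi (lift ord0 i)) t].
Proof.
apply: eq_from_tnth => i; rewrite tnth_mktuple.
by case: (unliftP ord0 i) => [j|] ->; rewrite ?tnthS ?tnth0 ?tnth_mktuple.
Qed.

Lemma measurable_prod_tnth n (w : 'I_n -> R -> R) :
  (forall i, measurable_fun [set: R] (w i)) ->
  measurable_fun [set: n.-tuple R] (fun t => \prod_(i < n) w i (tnth t i))%R.
Proof.
move=> mw; apply: measurable_prod => i _.
by apply: measurableT_comp => //; exact: measurable_tnth.
Qed.

(** A change of variables that holds in each coordinate holds for the product.
    With phi = id it gives densities of product measures, with w = 1 it gives
    images of product measures, and translation invariance when moreover nu and
    mu coincide. *)
Lemma ge0_integral_tprod_transform n (mu nu : 'I_n -> sfm)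
    (phi w : 'I_n -> R -> R) (h : n.-tuple R -> \bar R) :
  (forall i, measurable_fun [set: R] (phi i)) ->
  (forall i, measurable_fun [set: R] (w i)) -> (forall i x, (0 <= w i x)%R) ->
  (forall i (g : R -> \bar R), measurable_fun [set: R] g ->
    (forall x, 0 <= g x) ->
    \int[nu i]_x g x = \int[mu i]_x (g (phi i x) * (w i x)%:E)) ->
  measurable_fun [set: n.-tuple R] h -> (forall t, 0 <= h t) ->
  \int[tprod nu]_t h t =
  \int[tprod mu]_t (h (coord_map phi t) * (\prod_(i < n) w i (tnth t i))%:E).
Proof.
elim: n mu nu phi w h => [|n IH] mu nu phi w h mphi mw w0 nuE mh h0.
  rewrite !ge0_integral_tprod0//; last first.
    by move=> t; rewrite mule_ge0// lee_fin prodr_ge0.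
  by rewrite big_ord0 mule1 (tuple0 (coord_map _ _)).
have mh' : measurable_fun [set: n.+1.-tuple R] (fun t =>
    h (coord_map phi t) * (\prod_(i < n.+1) w i (tnth t i))%:E).
  apply: emeasurable_funM.
    by apply: measurableT_comp => //; exact: measurable_coord_map.
  by apply/measurable_EFinP; exact: measurable_prod_tnth.
have h'0 t : 0 <= h (coord_map phi t) * (\prod_(i < n.+1) w i (tnth t i))%:E.
  by rewrite mule_ge0// lee_fin prodr_ge0.
rewrite !ge0_integral_tprodS//.
pose phi' i := phi (lift ord0 i); pose w' i := w (lift ord0 i).
pose mu' i := mu (lift ord0 i).
pose G x := \int[tprod mu']_t
  (h [tuple of x :: coord_map phi' t] * (\prod_(i < n) w' i (tnth t i))%:E).
pose H (u : R * n.-tuple R) := h [tuple of u.1 :: coord_map phi' u.2] *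
  (\prod_(i < n) w' i (tnth u.2 i))%:E.
have mc : measurable_fun [set: R * n.-tuple R]
    (fun u => coord_map phi' u.2).
  apply: (@measurableT_comp _ _ _ _ _ _ (coord_map phi')) => //.
  by apply: measurable_coord_map => i; exact: mphi.
have mH : measurable_fun [set: R * n.-tuple R] H.
  apply: emeasurable_funM.
    by apply: measurableT_comp => //; exact: measurable_cons.
  apply/measurable_EFinP.
  apply: (@measurableT_comp _ _ _ _ _ _
    (fun t : n.-tuple R => \prod_(i < n) w' i (tnth t i))%R) => //.
  by apply: measurable_prod_tnth => i; exact: mw.
have H0 u : 0 <= H u by rewrite mule_ge0// lee_fin prodr_ge0// => i _; exact: w0.
have mG : measurable_fun [set: R] G.
  exact: (measurable_fun_fubini_tonelli_F (m2 := tprod mu') H mH H0).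
have G0 x : 0 <= G x by apply: integral_ge0 => t _; exact: (H0 (x, t)).
transitivity (\int[nu ord0]_x G x).
  apply: eq_integral => x _; rewrite (IH mu' _ phi' w')//.
  - by move=> i; exact: mphi.
  - by move=> i; exact: mw.
  - by move=> i; exact: w0.
  - by move=> i; exact: nuE.
  - by apply: (measurableT_comp mh); exact: measurable_cons.
rewrite nuE//; apply: eq_integral => x _.
rewrite -ge0_integralZr//.
- apply: eq_integral => t _; rewrite coord_map_cons big_ord_recl tnth0 EFinM.
  rewrite -muleA (muleC (w _ _)%:E); congr (_ * (_%:E * _)).
  by apply: eq_bigr => i _; rewrite tnthS.
- exact: (measurableT_comp mH (pair1_measurable _)).
- by move=> t _; exact: (H0 (phi ord0 x, t)).
- by rewrite lee_fin.
Qed.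

End tuple_measure.

(** * Lebesgue measure on tuples *)

Section lebesgue_on_tuples.
Context {R : realType}.
Local Open Scope ereal_scope.

(** Lebesgue measure on the default measurable structure of R, the one from
    which tuples are built; [lebesgue_measure] is attached to a copy of R with
    the same measurable sets but another display. *)
Definition leb : set R -> \bar R := @lebesgue_measure R.

Let leb0 : leb set0 = 0. Proof. exact: measure0. Qed.
Let leb_ge0 A : 0 <= leb A. Proof. exact: measure_ge0. Qed.
Let leb_additive : semi_sigma_additive leb.
Proof. exact: (@measure_semi_sigma_additive _ _ _ (@lebesgue_measure R)). Qed.
HB.instance Definition _ := isMeasure.Build _ R R leb leb0 leb_ge0 leb_additive.

Let leb_sigma_finite : sigma_finite [set: R] leb.
Proof. exact: (@sigma_finiteT _ _ _ (@lebesgue_measure R)). Qed.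
HB.instance Definition _ :=
  Measure_isSigmaFinite.Build _ R R leb leb_sigma_finite.

(** The two displays have the same measurable sets, so this is the
    transfer formula for the identity map. *)
Lemma ge0_integral_leb (f : R -> \bar R) :
  measurable_fun [set: R] f -> (forall x, 0 <= f x) ->
  \int[leb]_x f x = \int[lebesgue_measure]_x f x.
Proof.
move=> mf f0.
have mid : measurable_fun [set: measurableTypeR R] (idfun : measurableTypeR R -> R).
  by move=> _ Y mY; rewrite setTI.
by rewrite -[RHS](ge0_integral_pushforward mid (@lebesgue_measure R) measurableT mf).
Qed.

(** Both sides are measures that give ]a, b] the mass b - a. *)
Lemma ge0_integral_leb_shift (c : R) (f : R -> \bar R) :
  measurable_fun [set: R] f -> (forall x, 0 <= f x) ->
  \int[leb]_x f x = \int[leb]_x f (x + c)%R.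
Proof.
move=> mf f0; rewrite !ge0_integral_leb//; last first.
  by apply: (measurableT_comp mf); exact: measurable_funD.
have ms : measurable_fun [set: measurableTypeR R]
    ((fun x => x + c)%R : measurableTypeR R -> measurableTypeR R).
  exact: measurable_funD.
rewrite -[RHS](ge0_integral_pushforward ms (@lebesgue_measure R) measurableT mf)//.
apply: eq_integral_on_measurable => A mA.
pose nu0 := [the {measure set (measurableTypeR R) -> \bar R} of
  pushforward (@lebesgue_measure R)
    ((fun x => x + c)%R : measurableTypeR R -> measurableTypeR R)].
apply: (lebesgue_measure_unique (mu := nu0 ms)) => // _ [[a b]] _ <-.
rewrite /nu0/= /pushforward.
have -> : (fun x => x + c)%R @^-1` `]a, b]%classic = `](a - c)%R, (b - c)%R]%classic.
  by apply/seteqP; split=> x /=; rewrite !in_itv/= ltrBlDr lerBrDr.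
by rewrite !lebesgue_measure_itv/= !lte_fin ltrD2r -!EFinB; case: ifP => // _;
  congr EFin; ring.
Qed.

Lemma ge0_integral_lebN (f : R -> \bar R) :
  measurable_fun [set: R] f -> (forall x, 0 <= f x) ->
  \int[leb]_x f x = \int[leb]_x f (- x)%R.
Proof.
move=> mf f0; rewrite !ge0_integral_leb//; last first.
  by apply: (measurableT_comp mf); exact: oppr_measurable.
have ms : measurable_fun [set: measurableTypeR R]
    (-%R : measurableTypeR R -> measurableTypeR R).
  exact: oppr_measurable.
rewrite -[RHS](ge0_integral_pushforward ms (@lebesgue_measure R) measurableT mf)//.
apply: eq_integral_on_measurable => A mA.
by rewrite lebesgue_measureN.
Qed.

HB.instance Definition _ p := Measure.copy (@lebesgue_tuple R p)
  (tprod (fun _ : 'I_p => [the {sigma_finite_measure set R -> \bar R} of leb])).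
HB.instance Definition _ p := SigmaFiniteMeasure.copy (@lebesgue_tuple R p)
  (tprod (fun _ : 'I_p => [the {sigma_finite_measure set R -> \bar R} of leb])).

Definition shift_tuple p (c : 'cV[R]_p) (t : p.-tuple R) : p.-tuple R :=
  [tuple tnth t i + c i ord0 | i < p]%R.

Lemma measurable_shift_tuple p (c : 'cV[R]_p) :
  measurable_fun [set: p.-tuple R] (shift_tuple c).
Proof. rewrite (_ : shift_tuple c = coord_map (fun i x => x + c i ord0)%R)//.
by apply: measurable_coord_map => i; exact: measurable_funD. Qed.

Lemma colv_shift p (c : 'cV[R]_p) t : colv (shift_tuple c t) = (colv t + c)%R.
Proof.
by apply/colP => i; rewrite !mxE tnth_mktuple.
Qed.

Lemma ge0_integral_lebesgue_tuple_shift p (c : 'cV[R]_p) (f : p.-tuple R -> \bar R) :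
  measurable_fun [set: p.-tuple R] f -> (forall t, 0 <= f t) ->
  \int[@lebesgue_tuple R p]_t f t = \int[@lebesgue_tuple R p]_t f (shift_tuple c t).
Proof.
move=> mf f0.
rewrite [LHS](@ge0_integral_tprod_transform _ _ (fun=> leb) (fun=> leb)
  (fun i x => x + c i ord0)%R (fun _ _ => 1%R))//.
- by apply: eq_integral => t _; rewrite big1 ?mule1.
- by move=> i; exact: measurable_funD.
- move=> i g mg g0; rewrite [LHS](ge0_integral_leb_shift (c i ord0))//.
  by apply: eq_integral => x _; rewrite mule1.
Qed.

End lebesgue_on_tuples.

(** * Truncated normal laws *)

Section truncated_normal.
Context {R : realType}.
Implicit Types (m x t : R) (a : bool).
Local Open Scope ereal_scope.

Definition half_line a : set R :=
  if a then [set x | (0 < x)%R] else [set x | (x < 0)%R].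

Lemma half_lineE a :
  half_line a = if a then `]0%R, +oo[%classic else `]-oo, 0%R[%classic.
Proof. by case: a; apply/seteqP; split => x /=; rewrite in_itv/= ?andbT. Qed.

Lemma measurable_half_line a : measurable (half_line a).
Proof. by rewrite half_lineE; case: a. Qed.

Definition half_line_mass m a : R := fine (normal_prob m 1 (half_line a)).

Lemma normal_pdf1E m x :
  normal_pdf m 1 x = (@normal_peak R 1 * expR (- (2^-1 * (x - m) ^+ 2)))%R.
Proof.
rewrite normal_pdfE ?oner_eq0// /normal_fun expr1n; congr (_ * expR _)%R.
by rewrite mulNr mulrC.
Qed.

Lemma normal_probE m (A : set R) : measurable A ->
  normal_prob m 1 A = \int[@leb R]_x (normal_pdf m 1 x * \1_A x)%:E.
Proof.
move=> mA; rewrite ge0_integral_leb//.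
- rewrite /normal_prob integral_mkcond; apply: eq_integral => x _.
  by rewrite patchE indicE; case: ifPn => _; rewrite ?mulr1 ?mulr0.
- apply/measurable_EFinP/measurable_funM; first exact: measurable_normal_pdf.
  exact: measurable_indic.
- by move=> x; rewrite lee_fin mulr_ge0// normal_pdf_ge0.
Qed.

Lemma normal_prob_set1 m x : normal_prob m 1 [set x] = 0.
Proof.
have /null_content_dominatesP := normal_prob_dominates m (1 : R).
by apply => //; exact: lebesgue_measure_set1.
Qed.

(** If N is standard normal, then m + N > 0 has the probability of -N < m,
    hence of N < m by symmetry, and N = m has probability zero. *)
Lemma normal_prob_half_line_true m :
  normal_prob m 1 (half_line true) = normal_prob 0%R 1 `]-oo, m].
Proof.
have mf b (A : set R) : measurable A -> measurable_fun [set: R]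
    (fun x => (normal_pdf b 1 x * \1_A x)%:E).
  move=> mA; apply/measurable_EFinP/measurable_funM.
    exact: measurable_normal_pdf.
  exact: measurable_indic.
have f0 b (A : set R) x : 0 <= (normal_pdf b 1 x * \1_A x)%:E.
  by rewrite lee_fin mulr_ge0// normal_pdf_ge0.
rewrite normal_probE; last exact: measurable_half_line.
rewrite (ge0_integral_leb_shift m)//; last by apply: mf; exact: measurable_half_line.
have -> : \int[leb]_x (normal_pdf m 1 (x + m) * \1_(half_line true) (x + m))%:E =
    \int[leb]_x (normal_pdf 0 1 x * \1_(`](- m)%R, +oo[%classic) x)%:E.
  apply: eq_integral => x _; congr (_ * _)%:E.
    by rewrite !normal_pdf1E addrK subr0.
  by rewrite !indicE half_lineE !mem_setE !in_itv/= !andbT -(subr_gt0 (- m)) opprK.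
rewrite ge0_integral_lebN//; last exact: mf.
have -> : \int[leb]_x (normal_pdf 0 1 (- x) * \1_(`](- m)%R, +oo[%classic) (- x))%:E =
    \int[leb]_x (normal_pdf 0 1 x * \1_(`]-oo, m[%classic) x)%:E.
  apply: eq_integral => x _; congr (_ * _)%:E.
    by rewrite !normal_pdf1E !subr0 sqrrN.
  by rewrite !indicE !mem_setE !in_itv/= !andbT ltrN2.
rewrite -normal_probE//.
have -> : `]-oo, m]%classic = `]-oo, m[%classic `|` [set m] :> set R.
  by rewrite setUitv1.
rewrite measureU//; first by rewrite [X in _ + X]normal_prob_set1 adde0.
by apply/seteqP; split => x //= -[+ xm]; rewrite xm in_itv/= ltxx.
Qed.

(** The normalising constants of the truncated normal laws are the factors of
    the probit likelihood, so that multiplying the truncated laws by the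
    likelihood leaves a density without normalising constant. *)
Lemma half_line_massE m a :
  half_line_mass m a = (Phi m ^+ a * (1 - Phi m) ^+ (1 - a)%N)%R.
Proof.
case: a; rewrite /= ?expr1 ?expr0 ?mulr1 ?mul1r.
  by rewrite /half_line_mass normal_prob_half_line_true.
rewrite /half_line_mass /Phi -normal_prob_half_line_true.
have -> : half_line false = ~` (half_line true `|` [set 0%R]).
  apply/seteqP; split => x /=; first by move=> x0 [/ltW|x00]; lra.
  by move=> /not_orP[/negP x0 /eqP x00]; lra.
rewrite probability_setC; last first.
  by apply: measurableU => //; exact: measurable_half_line.
rewrite measureU//; last 2 first.
- exact: measurable_half_line.
- by apply/seteqP; split => x //= -[+ x0]; rewrite x0 ltxx.
rewrite [X in _ - (_ + X)]normal_prob_set1 adde0 fineB//.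
exact: (fin_num_measure (normal_prob m 1) _ (measurable_half_line true)).
Qed.

Lemma half_line_mass_gt0 m a : (0 < half_line_mass m a)%R.
Proof.
rewrite fine_gt0// -ge0_fin_numE// (fin_num_measure (normal_prob m 1)) ?andbT;
  last exact: measurable_half_line.
apply: integral_gt0.
- exact: measurable_half_line.
- by apply/measurable_EFinP/measurable_funTS; exact: measurable_normal_pdf.
- by move=> x _; rewrite lte_fin normal_pdf1E mulr_gt0 ?expR_gt0// normal_peak_gt0.
- by rewrite half_lineE; case: a => /=; rewrite lebesgue_measure_itv/= ?ltry ?ltNyr.
Qed.

Lemma half_line_mass_le1 m a : (half_line_mass m a <= 1)%R.
Proof.
rewrite -lee_fin fineK; first by apply: probability_le1; exact: measurable_half_line.
exact: (fin_num_measure (normal_prob m 1) _ (measurable_half_line a)).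
Qed.

Let trunc0 m a : trunc_normal m a set0 = 0.
Proof. by rewrite /trunc_normal set0I measure0 mul0e. Qed.

Let trunc_ge0 m a A : 0 <= trunc_normal m a A.
Proof. by rewrite mule_ge0// lee_fin invr_ge0 ltW// half_line_mass_gt0. Qed.

Let trunc_additive m a : semi_sigma_additive (trunc_normal m a).
Proof.
have k0 : (0 <= (half_line_mass m a)^-1)%R.
  by rewrite invr_ge0 ltW// half_line_mass_gt0.
have -> : trunc_normal m a = mscale (NngNum k0)
    (mrestr (normal_prob m 1) (measurable_half_line a)).
  by apply/funext => A; rewrite /trunc_normal /mscale/= /mrestr muleC.
exact: (@measure_semi_sigma_additive _ (measurableTypeR R) R (mscale (NngNum k0)
    (mrestr (normal_prob m 1) (measurable_half_line a)))).
Qed.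

HB.instance Definition _ m a := isMeasure.Build _ R R (trunc_normal m a)
  (trunc0 m a) (trunc_ge0 m a) (@trunc_additive m a).

Let trunc_setT m a : trunc_normal m a [set: R] = 1.
Proof.
rewrite /trunc_normal setTI -[X in X * _]fineK; last first.
  exact: (fin_num_measure (normal_prob m 1) _ (measurable_half_line a)).
by rewrite -EFinM divff// gt_eqF// half_line_mass_gt0.
Qed.

HB.instance Definition _ m a :=
  Measure_isProbability.Build _ R R (trunc_normal m a) (trunc_setT m a).

(** Left unnormalised: the normalising constant is a likelihood factor, which
    the joint density of parameter and latent variables does not contain. *)
Definition half_line_pdf m a x : R := normal_pdf m 1 x * \1_(half_line a) x.

Lemma half_line_pdf_ge0 m a x : (0 <= half_line_pdf m a x)%R.
Proof. by rewrite mulr_ge0// normal_pdf_ge0. Qed.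

Lemma ge0_integral_trunc_normal m a (f : R -> \bar R) :
  measurable_fun [set: R] f -> (forall x, 0 <= f x) ->
  \int[trunc_normal m a]_x f x =
  \int[@leb R]_x (f x * (half_line_pdf m a x / half_line_mass m a)%:E).
Proof.
move=> mf f0; have k0 : (0 <= (half_line_mass m a)^-1)%R.
  by rewrite invr_ge0 ltW// half_line_mass_gt0.
have mp : measurable_fun [set: R] (half_line_pdf m a).
  apply: measurable_funM; first exact: measurable_normal_pdf.
  by apply: measurable_indic; exact: measurable_half_line.
apply: ge0_integral_density => //.
- exact: measurable_funM.
- by move=> x; rewrite mulr_ge0// half_line_pdf_ge0.
- move=> A mA; transitivity (normal_prob m 1 (A `&` half_line a) *
    ((half_line_mass m a)^-1)%:E) => //; rewrite normal_probE; last first.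
    by apply: measurableI => //; exact: measurable_half_line.
  rewrite [RHS]integral_mkcond -ge0_integralZr//.
  + apply: eq_integral => x _; rewrite patchE -EFinM /half_line_pdf indicI/=.
    case: ifPn => xA; rewrite indicE ?xA ?(negbTE xA) ?mul1r ?mul0r ?mulr0 ?mul0r//.
  + apply/measurable_EFinP/measurable_funM; first exact: measurable_normal_pdf.
    by apply: measurable_indic; apply: measurableI => //; exact: measurable_half_line.
  + by move=> x _; rewrite lee_fin mulr_ge0// normal_pdf_ge0.
Qed.

End truncated_normal.

(** * The quantile transform *)

Section quantile.
Context {R : realType}.
Implicit Types (P : probability R R) (t u : R).

Definition ray_mass P t : R := fine (P `]-oo, t]%classic).

Lemma ray_massK P t : (ray_mass P t)%:E = P `]-oo, t]%classic.
Proof. by rewrite fineK// fin_num_measure. Qed.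

Lemma ray_mass_ge0 P t : 0 <= ray_mass P t.
Proof. exact/fine_ge0/measure_ge0. Qed.

Lemma ray_mass_le1 P t : ray_mass P t <= 1.
Proof. by rewrite -lee_fin ray_massK probability_le1. Qed.

Lemma ray_mass_mono P : {homo ray_mass P : s t / s <= t}.
Proof.
move=> s t st; rewrite -lee_fin !ray_massK le_measure ?inE//.
exact: subset_itvl.
Qed.

(** The value 0 is arbitrary: the complement of ]0, 1[ is negligible for the
    uniform law to which the quantile is applied. *)
Definition quantile P u : R :=
  if (0 < u < 1) then inf [set t | u <= ray_mass P t] else 0.

Let ray_cdf P : exists X : {RV P >-> R}, forall t, (ray_mass P t)%:E = cdf X t.
Proof.
have mid : measurable_fun [set: R] (idfun : R -> R).
  exact: measurable_id.
pose X : {RV P >-> R} := HB.pack (idfun : R -> R) (isMeasurableFun.Build _ _ _ _ _ mid).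
exists X => t; rewrite ray_massK.
reflexivity.
Qed.

(** The infimum is attained because distribution functions are right
    continuous. Order, measurability and law of the quantile all follow from
    this equivalence. *)
Lemma quantile_le P u t : 0 < u < 1 ->
  (quantile P u <= t) = (u <= ray_mass P t).
Proof.
move=> /[dup] u01 /andP[u0 u1]; rewrite /quantile u01.
have [X XE] := ray_cdf P.
set S := [set t | _].
have Sinf : has_inf S.
  split.
    apply: contrapT => S0; move: u1; rewrite ltNge -lee_fin => /negP; apply.
    apply: (cvge_le _ (cvg_cdfy1 X)); apply: nearW => x.
    rewrite -XE lee_fin leNgt; apply/negP => /ltW ux.
    by apply: S0; exists x.
  apply: contrapT => Snlb; move: u0; rewrite ltNge -lee_fin => /negP; apply.
  apply: (cvge_ge _ (cvg_cdfNy0 X)); apply: nearW => x.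
  rewrite -XE lee_fin leNgt; apply/negP => xu; apply: Snlb.
  exists x => s us; rewrite leNgt; apply/negP => sx.
  by move: xu; rewrite ltNge (le_trans us)// ray_mass_mono// ltW.
apply/idP/idP => [qt|ut]; last by apply: ge_inf => //; case: Sinf.
have uS s : t < s -> u <= ray_mass P s.
  move=> ts; have [x Sx xs] := inf_lt Sinf.1 (le_lt_trans qt ts).
  exact: le_trans Sx (ray_mass_mono _ (ltW xs)).
have Xt : cdf X s @[s --> t^'+] --> cdf X t := @cdf_right_continuous _ _ _ _ X t.
rewrite -lee_fin XE; apply: (cvge_ge _ Xt).
by near=> s; rewrite -XE lee_fin uS//; near: s; exact: nbhs_right_gt.
Unshelve. all: by end_near. Qed.

(** A comparison of distribution functions becomes a pointwise comparison of
    quantiles taken at the same level u. *)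
Lemma quantile_le_shift P P' (c u : R) : 0 <= c ->
  (forall t, ray_mass P t <= ray_mass P' (t + c)) ->
  quantile P' u <= quantile P u + c.
Proof.
move=> c0 PP'; have [u01|u01] := boolP (0 < u < 1); last first.
  by rewrite /quantile (negbTE u01) add0r.
by rewrite quantile_le// (le_trans _ (PP' _))// -quantile_le.
Qed.

(** The quantile exceeds t exactly when the level exceeds the distribution
    function at t, so only the latter has to be measurable in the parameter. *)
Lemma measurable_quantile d (T : measurableType d) (P : T -> probability R R) :
  (forall t, measurable_fun [set: T] (fun x => ray_mass (P x) t)) ->
  measurable_fun [set: T * R] (fun xu => quantile (P xu.1) xu.2).
Proof.
move=> mP; apply: (@measurability _ _ _ _ _ _ (@RGenOInfty.G R)).
  exact: RGenOInfty.measurableE.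
move=> _ [_] [t ->] <-; rewrite setTI.
have m1 : measurable_fun [set: T * R] (fun xu : T * R => 0 < xu.2 < 1).
  by apply: measurable_and; exact: measurable_fun_ltr.
pose b (xu : T * R) := if 0 < xu.2 < 1 then ray_mass (P xu.1) t < xu.2 else t < 0.
have mb : measurable_fun [set: T * R] b.
  apply: measurable_fun_ifT => //; apply: measurable_fun_ltr => //.
  exact: (measurableT_comp (mP t)).
suff -> : (fun xu => quantile (P xu.1) xu.2) @^-1` `]t, +oo[ =
    [set: T * R] `&` b @^-1` [set true] by exact: mb.
rewrite setTI; apply/seteqP; split=> -[x u] /=; rewrite in_itv/= andbT /b/=;
  (have [u01|u01] := boolP (0 < u < 1); last by rewrite /quantile (negbTE u01)).
  by rewrite !ltNge quantile_le// => /negP.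
by rewrite !ltNge quantile_le.
Qed.

Definition unif01 : set R -> \bar R := fun A => leb (A `&` `]0, 1[%classic).

Let unif01_measure : exists m : {measure set R -> \bar R},
  unif01 = m :> (set R -> \bar R).
Proof.
have m01 : measurable (`]0, 1[%classic : set R) by [].
by exists [the {measure set R -> \bar R} of mrestr (@leb R) m01].
Qed.

Let unif0 : unif01 set0 = 0%E.
Proof. by rewrite /unif01 set0I measure0. Qed.
Let unif_ge0 A : (0 <= unif01 A)%E. Proof. exact: measure_ge0. Qed.
Let unif_additive : semi_sigma_additive unif01.
Proof.
have [m ->] := unif01_measure; exact: measure_semi_sigma_additive.
Qed.
HB.instance Definition _ := isMeasure.Build _ R R unif01 unif0 unif_ge0 unif_additive.

Let unif_setT : unif01 [set: R] = 1%E.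
Proof.
by rewrite /unif01 setTI /leb lebesgue_measure_itv/= lte_fin ltr01 oppr0 adde0.
Qed.
HB.instance Definition _ := Measure_isProbability.Build _ R R unif01 unif_setT.

Lemma measurable_quantile1 P : measurable_fun [set: R] (quantile P).
Proof.
have mq := @measurable_quantile _ R (fun=> P) (fun t => measurable_cst _).
exact: (measurableT_comp mq (pair1_measurable (0 : R))).
Qed.

(** The quantile of a uniform variable is at most t exactly when the variable
    is at most the distribution function at t. Half-lines determine a
    probability. *)
Lemma quantile_law P (A : set R) : measurable A ->
  unif01 (quantile P @^-1` A) = P A.
Proof.
pose m0 := [the {measure set R -> \bar R} of pushforward unif01 (quantile P)].
pose m := m0 (measurable_quantile1 P).
have mT : m setT = 1%E by rewrite /m/= /pushforward preimage_setT unif_setT.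
move=> mA; apply: (measure_unique (@RGenOInfty.G R)
  (fun n => `]- n%:R, +oo[%classic) _ _ _ _ m P) => //.
- exact: RGenOInfty.measurableE.
- move=> _ _ [s ->] [t ->]; exists (Num.max s t).
  by apply/seteqP; split=> x /=; rewrite !in_itv/= !andbT gt_max => /andP.
- by move=> i; exists (- i%:R).
- rewrite -subTset => x _; exists (Num.bound `|x|) => //=.
  rewrite in_itv/= andbT ltrNl (le_lt_trans (ler_norm _))// normrN.
  exact: archi_boundP.
- move=> _ [t ->].
  have compl (mu : {measure set R -> \bar R}) : mu setT = 1%E ->
      mu `]t, +oo[%classic = (1 - mu `]-oo, t]%classic)%E.
    move=> muT; rewrite -setCitvl -setTD measureD ?setTI//.
      by congr (_ - _)%E.
    by rewrite [ltLHS]muT ltry.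
  rewrite (compl m mT) (compl P (probability_setT P)).
  suff -> : m `]-oo, t]%classic = P `]-oo, t]%classic by [].
  rewrite /m/= /pushforward -ray_massK /unif01.
  have -> : quantile P @^-1` `]-oo, t]%classic `&` `]0, 1[%classic =
      [set` if ray_mass P t < 1 then `]0, ray_mass P t] else `]0, 1[].
    case: ifPn => F1; apply/seteqP; split=> u /=; rewrite !in_itv/=.
    - by move=> [qt /[dup] u01 /andP[-> _]]; rewrite -quantile_le.
    - move=> /andP[u0 uF].
      have u01 : 0 < u < 1 by rewrite u0 (le_lt_trans uF).
      by rewrite quantile_le.
    - by case.
    - move=> u01; rewrite quantile_le//; split => //.
      by move: F1 u01; rewrite -leNgt => F1 /andP[_ /ltW]/le_trans; exact.
  have F0 := ray_mass_ge0 P t.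
  case: ifPn => F1; rewrite /leb lebesgue_measure_itv/= lte_fin oppr0 adde0.
    case: ifPn => //; rewrite -leNgt => F0'.
    by congr EFin; apply/eqP; rewrite eq_le F0 F0'.
  by rewrite ltr01; congr EFin; apply/eqP; rewrite eq_le ray_mass_le1 leNgt F1.
- by move=> k; rewrite (@le_lt_trans _ _ 1%E) ?ltry// -mT le_measure ?inE.
Qed.

End quantile.

(** * Truncated normal laws as functions of their location *)

Section truncated_normal_order.
Context {R : realType}.
Implicit Types (m t c : R) (a : bool) (A B : set R).

Let normal_mass m A : R := fine (normal_prob m 1 A).

Let normal_massK m A : measurable A -> (normal_mass m A)%:E = normal_prob m 1 A.
Proof. by move=> mA; rewrite fineK// (fin_num_measure (normal_prob m 1)). Qed.

Let normal_mass_ge0 m A : 0 <= normal_mass m A.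
Proof. exact/fine_ge0/measure_ge0. Qed.

Let normal_mass0 m : normal_mass m set0 = 0.
Proof. by apply/EFin_inj; rewrite normal_massK// measure0. Qed.

Let normal_mass_mono m A B : measurable A -> measurable B -> A `<=` B ->
  normal_mass m A <= normal_mass m B.
Proof.
move=> mA mB AB; rewrite -lee_fin !normal_massK//.
by apply: le_measure => //; rewrite inE.
Qed.

Let normal_massU m A B : measurable A -> measurable B -> A `&` B = set0 ->
  normal_mass m (A `|` B) = normal_mass m A + normal_mass m B.
Proof.
move=> mA mB AB; apply/EFin_inj; rewrite EFinD !normal_massK//; last exact: measurableU.
by rewrite [LHS]measureU.
Qed.

(** The likelihood ratio of two locations m <= m' is increasing in x. *)
Lemma normal_pdf_ratio m m' x : normal_pdf m' 1 x =
  normal_pdf m 1 x * expR (x * (m' - m) - (m' ^+ 2 - m ^+ 2) / 2).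
Proof.
rewrite !normal_pdf1E -mulrA -expRD; congr (_ * expR _).
by field.
Qed.

Let normal_mass_shift m m' A : measurable A ->
  normal_mass m' A = normal_mass m ((fun x => x + (m' - m)) @^-1` A).
Proof.
move=> mA; have ms : measurable_fun [set: R] (fun x : R => x + (m' - m)).
  exact: measurable_funD.
have mA' : measurable ((fun x => x + (m' - m)) @^-1` A).
  by rewrite -[X in measurable X]setTI; exact: ms.
congr (fine _); rewrite !normal_probE// (ge0_integral_leb_shift (m' - m)).
- apply: eq_integral => x _; rewrite !normal_pdf1E.
  by congr (_ * expR (- (_ * _ ^+ 2)) * _)%:E; ring.
- apply/measurable_EFinP/measurable_funM; first exact: measurable_normal_pdf.
  exact: measurable_indic.
- by move=> x; rewrite lee_fin mulr_ge0// normal_pdf_ge0.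
Qed.

Let normal_mass_ratio_le m m' r A : measurable A ->
  (forall x, A x -> normal_pdf m' 1 x <= r * normal_pdf m 1 x) -> 0 <= r ->
  normal_mass m' A <= r * normal_mass m A.
Proof.
move=> mA mm' r0; rewrite -lee_fin EFinM !normal_massK// /normal_prob.
have mpdf b : measurable_fun A (EFin \o normal_pdf b 1).
  by apply/measurable_EFinP/measurable_funTS; exact: measurable_normal_pdf.
rewrite -ge0_integralZl//=.
- apply: ge0_le_integral => //.
  + by move=> x _; rewrite lee_fin normal_pdf_ge0.
  + exact: mpdf.
  + by apply: emeasurable_funM => //; exact: mpdf.
- exact: mpdf.
- by move=> x _; rewrite lee_fin normal_pdf_ge0.
Qed.

Let normal_mass_ratio_ge m m' r A : measurable A ->
  (forall x, A x -> r * normal_pdf m 1 x <= normal_pdf m' 1 x) -> 0 <= r ->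
  r * normal_mass m A <= normal_mass m' A.
Proof.
move=> mA mm' r0; rewrite -lee_fin EFinM !normal_massK// /normal_prob.
have mpdf b : measurable_fun A (EFin \o normal_pdf b 1).
  by apply/measurable_EFinP/measurable_funTS; exact: measurable_normal_pdf.
rewrite -ge0_integralZl//=.
- apply: ge0_le_integral => //.
  + by move=> x _; rewrite lee_fin mulr_ge0 ?normal_pdf_ge0.
  + by apply: emeasurable_funM => //; exact: mpdf.
  + exact: mpdf.
- exact: mpdf.
- by move=> x _; rewrite lee_fin normal_pdf_ge0.
Qed.

Lemma ray_mass_trunc_normal m a t : ray_mass (trunc_normal m a) t =
  fine (normal_prob m 1 (`]-oo, t]%classic `&` half_line a)) / half_line_mass m a.
Proof.
apply/EFin_inj; rewrite ray_massK EFinM [in RHS]normal_massK//.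
by apply: measurableI => //; exact: measurable_half_line.
Qed.

Let ray_mass_normal_mass m a t : ray_mass (trunc_normal m a) t =
  normal_mass m (`]-oo, t]%classic `&` half_line a) / normal_mass m (half_line a).
Proof. exact: ray_mass_trunc_normal. Qed.

Let half_line_gt0 m a : 0 < normal_mass m (half_line a).
Proof. exact: half_line_mass_gt0. Qed.

(* From here on masses are handled through the facts above only. *)
Opaque normal_mass.

Let half_line_split m a t : normal_mass m (half_line a) =
  normal_mass m (`]-oo, t]%classic `&` half_line a) +
  normal_mass m (`]t, +oo[%classic `&` half_line a).
Proof.
have mI := measurable_half_line (R := R) a.
rewrite -normal_massU; [|exact: measurableI|exact: measurableI|].
- by rewrite -setIUl -setCitvl setUv setTI.
- by rewrite setIACA -setCitvl setICr set0I.
Qed.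

Let ratio_le (x y a i b j : R) : x = a / i -> y = b / j ->
  0 < i -> 0 < j -> a * j <= b * i -> x <= y.
Proof. by move=> -> -> i0 j0 h; rewrite ler_pdivrMr// mulrAC ler_pdivlMr. Qed.

Let split_le (a b a' b' r : R) : 0 <= a -> 0 <= b -> a' <= r * a -> r * b <= b' ->
  a' * (a + b) <= a * (a' + b').
Proof. nra. Qed.

Let tail_le (k s i s' j : R) : 0 <= k -> i <= j -> i = s + k -> j = s' + k ->
  s * j <= s' * i.
Proof.
move=> k0 ij iE jE; have ss' : s <= s' by move: ij; rewrite iE jE lerD2r.
by rewrite iE jE !mulrDr (mulrC s) lerD2l ler_wpM2r.
Qed.

(** Let r be the likelihood ratio at t. From m to m', the masses of the two
    parts of the half-line are multiplied by at most r below t and by at least r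
    above t, so the proportion that lies below t decreases. *)
Lemma ray_mass_trunc_normal_anti m m' a t : m <= m' ->
  ray_mass (trunc_normal m' a) t <= ray_mass (trunc_normal m a) t.
Proof.
move=> mm'.
apply: (ratio_le (ray_mass_normal_mass m' a t) (ray_mass_normal_mass m a t));
  [exact: half_line_gt0|exact: half_line_gt0|].
rewrite (half_line_split m a t) (half_line_split m' a t).
set A := `]-oo, t]%classic `&` _; set B := `]t, +oo[%classic `&` _.
have mA : measurable A by apply: measurableI => //; exact: measurable_half_line.
have mB : measurable B by apply: measurableI => //; exact: measurable_half_line.
(* The likelihood ratio at t. *)
pose r := expR (t * (m' - m) - (m' ^+ 2 - m ^+ 2) / 2).
apply: (@split_le _ _ _ _ r); [exact: normal_mass_ge0|exact: normal_mass_ge0| |].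
- apply: normal_mass_ratio_le; rewrite ?expR_ge0// => x [/= xt _].
  rewrite (normal_pdf_ratio m m') mulrC ler_wpM2r ?normal_pdf_ge0// ler_expR lerD2r.
  by rewrite ler_wpM2r ?subr_ge0//; move: xt; rewrite in_itv.
- apply: normal_mass_ratio_ge; rewrite ?expR_ge0// => x [/= xt _].
  rewrite (normal_pdf_ratio m m') [leRHS]mulrC ler_wpM2r ?normal_pdf_ge0//.
  rewrite ler_expR lerD2r ler_wpM2r ?subr_ge0//.
  by move: xt; rewrite in_itv/= andbT => /ltW.
Qed.

(** Translated by m - m', the law at m' is the normal law N(m, 1) conditioned
    on the half-line J obtained by moving the original one to the left. For the
    positive half-line this adds points below all others, for the negative one
    it removes points above all others; either way the law is shifted downwards. *)
Lemma ray_mass_trunc_normal_shift m m' a t : m <= m' ->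
  ray_mass (trunc_normal m a) t <=
  ray_mass (trunc_normal m' a) (t + (m' - m)).
Proof.
move=> mm'.
apply: (ratio_le (ray_mass_normal_mass m a t)
  (ray_mass_normal_mass m' a (t + (m' - m))));
  [exact: half_line_gt0|exact: half_line_gt0|].
have mI b : measurable (half_line b : set R) := measurable_half_line b.
pose J := (fun x => x + (m' - m)) @^-1` half_line a.
have mJ : measurable J.
  have ms : measurable_fun [set: R] (fun x : R => x + (m' - m)).
    exact: measurable_funD.
  by rewrite -[X in measurable X]setTI; apply: ms.
have -> : normal_mass m' (half_line a) = normal_mass m J by exact: normal_mass_shift.
have -> : normal_mass m' (`]-oo, t + (m' - m)]%classic `&` half_line a) =
    normal_mass m (`]-oo, t]%classic `&` J).
  rewrite (normal_mass_shift m); last exact: measurableI.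
  congr (normal_mass _ _); rewrite preimage_setI; congr (_ `&` _).
  by apply/seteqP; split=> x /=; rewrite !in_itv/= lerD2r.
have JE x : J x = half_line a (x + (m' - m)) by [].
clearbody J; case: a JE => JE.
- have IJ : half_line true `<=` J.
    by move=> x; rewrite JE/=; lra.
  have [t0|t0] := leP t 0.
    have -> : `]-oo, t]%classic `&` half_line true = set0.
      by apply/seteqP; split=> x //=; rewrite in_itv/=; lra.
    by rewrite normal_mass0 mul0r; apply: mulr_ge0; exact: normal_mass_ge0.
  apply: (@tail_le (normal_mass m (`]t, +oo[%classic `&` half_line true))).
  + exact: normal_mass_ge0.
  + exact: normal_mass_mono.
  + exact: half_line_split.
  + rewrite -normal_massU; [|exact: measurableI|exact: measurableI|].
    * congr (normal_mass _ _); apply/seteqP; split=> x /=; rewrite !in_itv/= andbT.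
        by have [xt|tx] := leP x t => Jx; [left|right; split => //; lra].
      by case=> [[]|[_ /IJ]].
    * by apply/seteqP; split=> x //=; rewrite !in_itv/= andbT; lra.
- have JI : J `<=` half_line false.
    by move=> x; rewrite JE/=; lra.
  have [t0|t0] := leP (- (m' - m)) t.
    have -> : `]-oo, t]%classic `&` J = J.
      by apply/seteqP; split=> x //=; [case|rewrite JE/= in_itv/=; lra].
    rewrite mulrC; apply: ler_wpM2l; first exact: normal_mass_ge0.
    by apply: normal_mass_mono; [exact: measurableI|exact: mI|exact: subIsetr].
  have -> : `]-oo, t]%classic `&` J = `]-oo, t]%classic `&` half_line false.
    by apply/seteqP; split=> x /=; rewrite JE/= in_itv/=; lra.
  by apply: ler_wpM2l; [exact: normal_mass_ge0|exact: normal_mass_mono].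
Qed.

Definition trunc_quantile a (mu : R * R) : R :=
  quantile (trunc_normal mu.1 a) mu.2.

Lemma measurable_trunc_quantile a :
  measurable_fun [set: R * R] (trunc_quantile a).
Proof.
apply: (@measurable_quantile _ _ R (fun m => trunc_normal m a)) => t.
apply: nonincreasing_measurable; first exact: measurableT.
by move=> m m' mm'; exact: ray_mass_trunc_normal_anti.
Qed.

(** The two stochastic comparisons say that the quantile is nondecreasing in
    the location and that quantile minus location is nonincreasing. *)
Lemma trunc_quantile_lip a m m' u :
  `|trunc_quantile a (m, u) - trunc_quantile a (m', u)| <= `|m - m'|.
Proof.
wlog mm' : m m' / m <= m'.
  move=> H; have [|/ltW] := leP m m'; first exact: H.
  by rewrite distrC (distrC m); exact: H.
have mm0 : 0 <= m' - m by rewrite subr_ge0.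
rewrite (distrC m) (ger0_norm mm0) distrC ger0_norm; last first.
  rewrite subr_ge0 -[leRHS]addr0; apply: (@quantile_le_shift _ (trunc_normal m' a)
    (trunc_normal m a)) => [|t]; first exact: lexx.
  rewrite addr0; exact: ray_mass_trunc_normal_anti.
rewrite lerBlDl; apply: (@quantile_le_shift _ (trunc_normal m a)
  (trunc_normal m' a) _ _ mm0) => t; exact: ray_mass_trunc_normal_shift.
Qed.

End truncated_normal_order.

(** * Quadratic forms and the largest eigenvalue *)

Section quadratic_forms.
Context {R : realType}.

Definition bform p (S : 'M[R]_p) (u w : 'cV[R]_p) : R := (u^T *m S *m w) ord0 ord0.

(** The squared Euclidean norm, as a quadratic form so that the same
    identities apply to it. *)
Definition sqnorm p (u : 'cV[R]_p) : R := qform 1%:M u.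

Section bilinear.
Context {p : nat}.
Implicit Types (S Q : 'M[R]_p) (u w : 'cV[R]_p).

Lemma bformDl S u u' w : bform S (u + u') w = bform S u w + bform S u' w.
Proof. by rewrite /bform linearD/= !mulmxDl mxE. Qed.

Lemma bformDr S u w w' : bform S u (w + w') = bform S u w + bform S u w'.
Proof. by rewrite /bform mulmxDr mxE. Qed.

Lemma bformZl S a u w : bform S (a *: u) w = a * bform S u w.
Proof. by rewrite /bform linearZ/= -!scalemxAl mxE. Qed.

Lemma bformZr S a u w : bform S u (a *: w) = a * bform S u w.
Proof. by rewrite /bform -scalemxAr mxE. Qed.

Lemma bformC S u w : S^T = S -> bform S u w = bform S w u.
Proof.
move=> symS; rewrite /bform -[in LHS](trmxK (u^T *m S *m w)) mxE.
by rewrite !trmx_mul trmxK symS mulmxA.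
Qed.

Lemma bformDS S S' u w : bform (S + S') u w = bform S u w + bform S' u w.
Proof. by rewrite /bform mulmxDr mulmxDl mxE. Qed.

Lemma bform_mulmx S u w : bform S u w = bform 1%:M u (S *m w).
Proof. by rewrite /bform mulmx1 mulmxA. Qed.

Lemma qformE S u : qform S u = bform S u u. Proof. by []. Qed.

Lemma qformD S u w : S^T = S ->
  qform S (u + w) = qform S u + 2 * bform S u w + qform S w.
Proof.
move=> symS; rewrite !qformE !bformDl !bformDr (bformC w u symS); ring.
Qed.

Lemma qformZ S a u : qform S (a *: u) = a ^+ 2 * qform S u.
Proof. by rewrite !qformE bformZl bformZr mulrA. Qed.

Lemma qformN S u : qform S (- u) = qform S u.
Proof. by rewrite -scaleN1r qformZ sqrrN expr1n mul1r. Qed.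

Lemma qform0 S : qform S 0 = 0.
Proof. by rewrite /qform mulmx0 mxE. Qed.

Lemma qformB S u w : S^T = S ->
  qform S (u - w) = qform S u - 2 * bform S u w + qform S w.
Proof.
move=> symS; rewrite qformD// qformN -scaleN1r bformZr; ring.
Qed.

Lemma qform_sum S u :
  qform S u = \sum_i \sum_j u i ord0 * S i j * u j ord0.
Proof.
rewrite /qform mxE exchange_big/=; apply: eq_bigr => j _.
rewrite mxE mulr_suml; apply: eq_bigr => i _.
by rewrite mxE.
Qed.

Lemma sqnormE u : sqnorm u = \sum_i u i ord0 ^+ 2.
Proof.
rewrite /sqnorm /qform mulmx1 mxE; apply: eq_bigr => i _.
by rewrite mxE expr2.
Qed.

Lemma sqnorm_ge0 u : 0 <= sqnorm u.
Proof. by rewrite sqnormE sumr_ge0// => i _; rewrite sqr_ge0. Qed.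

Lemma sqnorm_gt0 u : u != 0 -> 0 < sqnorm u.
Proof.
move=> u0; rewrite lt0r sqnorm_ge0 andbT; apply: contra u0 => /eqP.
rewrite sqnormE => /eqP; rewrite psumr_eq0; last by move=> i _; rewrite sqr_ge0.
move=> /allP ui; apply/eqP/colP => i; rewrite mxE.
by have := ui i; rewrite mem_index_enum sqrf_eq0 => /(_ isT)/eqP.
Qed.

Lemma posdef_ge0 S u : posdef S -> 0 <= qform S u.
Proof.
move=> [_ S0]; have [->|/S0/ltW//] := eqVneq u 0.
by rewrite qform0.
Qed.

Lemma posdef_unitmx S : posdef S -> S \in unitmx.
Proof.
move=> [_ S0]; rewrite -row_free_unit -kermx_eq0; apply/rowV0P => w.
move=> /sub_kermxP wS; apply/eqP; apply: contraT => w0.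
have := S0 w^T; rewrite trmx_eq0 => /(_ w0).
by rewrite /qform trmxK wS mul0mx mxE ltxx.
Qed.

End bilinear.

Lemma qform_congruence p n (X : 'M[R]_(n, p)) (S : 'M[R]_n) u :
  qform (X^T *m S *m X) u = qform S (X *m u).
Proof. by rewrite /qform trmx_mul !mulmxA. Qed.

Section sphere.
Context {p : nat}.
Implicit Types (S Q : 'M[R]_p) (u w : 'cV[R]_p).

Let sphere : set 'rV[R]_p := [set u | sqnorm u^T = 1].

Let continuous_qform S : continuous (fun u : 'rV[R]_p => qform S u^T).
Proof.
have -> : (fun u : 'rV[R]_p => qform S u^T) = (fun u : 'rV[R]_p =>
    \sum_i \sum_j u ord0 i * S i j * u ord0 j).
  apply/funext => u; rewrite qform_sum.
  by apply: eq_bigr => i _; apply: eq_bigr => j _; rewrite !mxE.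
apply: continuous_big => [|i _]; first exact: add_continuous.
apply: continuous_big => [|j _ u]; first exact: add_continuous.
apply: (@continuousM _ _ (fun v : 'rV[R]_p => v ord0 i * S i j)
  (fun v : 'rV[R]_p => v ord0 j)); last exact: coord_continuous.
apply: (@continuousM _ _ (fun v : 'rV[R]_p => v ord0 i) (fun=> S i j)).
  exact: coord_continuous.
exact: cst_continuous.
Qed.

Let compact_sphere : compact sphere.
Proof.
apply: bounded_closed_compact.
  exists 1; split => // M M1 u u1 /=.
  rewrite [leLHS]/Num.norm/= mx_normrE.
  apply/bigmax_leP; split; first exact/ltW/(lt_trans ltr01).
  move=> -[i j] _ /=.
  rewrite (le_trans _ (ltW M1))// ord1 -(@ler_pXn2r _ 2)// ?nnegrE// expr1n.
  rewrite real_normK ?num_real// -u1 sqnormE (bigD1 j)//= mxE.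
  by rewrite lerDl sumr_ge0// => k _; rewrite sqr_ge0.
rewrite (_ : sphere = (fun u : 'rV[R]_p => qform 1%:M u^T) @^-1` [set 1])//.
apply: closed_comp => [u _|]; first exact: continuous_qform.
exact: closed_eq.
Qed.

(** The form attains a maximum on the compact unit sphere, and the inequality
    is homogeneous. *)
Lemma qform_max S : (0 < p)%N ->
  exists2 w : 'cV[R]_p, sqnorm w = 1 & forall u, qform S u <= qform S w * sqnorm u.
Proof.
move=> p0; have S0 : sphere !=set0.
  exists (delta_mx ord0 (Ordinal p0)); rewrite /sphere/= sqnormE.
  rewrite (bigD1 (Ordinal p0))//= big1 ?addr0; first by rewrite !mxE !eqxx expr1n.
  by move=> i /negbTE i0; rewrite !mxE i0 andbF expr0n.
have [c c1 cmax] := EVT_max_rV S0 compact_sphere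
  (continuous_subspaceT (@continuous_qform S)).
exists c^T; first by move: c1; rewrite inE.
move=> u; have [->|u0] := eqVneq u 0.
  by rewrite /sqnorm !qform0 mulr0.
have n0 := sqnorm_gt0 u0.
pose a := (Num.sqrt (sqnorm u))^-1.
have a2 : a ^+ 2 = (sqnorm u)^-1 by rewrite exprVn sqr_sqrtr// ltW.
have := cmax (a *: u)^T; rewrite trmxK qformZ a2 inE.
rewrite mulrC ler_pdivrMr//; apply.
by rewrite /sphere/= trmxK /sqnorm qformZ a2 mulVf// gt_eqF.
Qed.

(** Compare the maximum of S with the minimum of Q on the unit sphere; the
    latter is positive because it is attained. *)
Lemma qform_dominated S Q : posdef Q ->
  exists2 k, 0 < k & forall u, qform S u <= k * qform Q u.
Proof.
move=> Qpd; have [p0|] := posnP p.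
  exists 1 => // u; suff -> : u = 0 by rewrite !qform0 mulr0.
  by apply/colP => -[i Hi]; exfalso; move: Hi; rewrite p0.
move=> p0; have [w _ Hw] := qform_max S p0.
have [w' w'1 Hw'] := qform_max (- Q) p0.
have qN u : qform (- Q) u = - qform Q u.
  by rewrite /qform mulmxN mulNmx mxE.
have c0 : 0 < qform Q w'.
  have [_] := Qpd; apply; apply/eqP => w'0; move: w'1; rewrite w'0 /sqnorm qform0.
  by move/eqP; rewrite eq_sym oner_eq0.
exists ((`|qform S w| + 1) / qform Q w'); first by rewrite divr_gt0// ltr_wpDl.
move=> u; rewrite (le_trans (Hw u))// mulrAC ler_pdivlMr//.
have := Hw' u; rewrite !qN mulNr lerN2 => H.
have h1 := ler_norm (qform S w); have h2 := sqnorm_ge0 u.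
apply: (@le_trans _ _ ((`|qform S w| + 1) * (qform Q w' * sqnorm u))); last first.
  by rewrite ler_wpM2l// addr_ge0.
rewrite mulrAC -mulrA ler_wpM2r ?mulr_ge0// ?ltW//.
by rewrite (le_lt_trans h1)// ltrDl.
Qed.

(** A maximiser w of the form on the unit sphere, with value l, is an
    eigenvector: at w + t h, with h = S w - l w, the form minus l times the squared
    norm is at most 0 and has the first-order term 2 t |h|^2, so that h = 0. Moreover
    l bounds every eigenvalue, so that the supremum defining [lambda_max] is
    bounded and at least l. *)
Lemma rayleigh S : (0 < p)%N -> S^T = S ->
  forall u, qform S u <= lambda_max S * sqnorm u.
Proof.
move=> p0 symS; have [w w1 Hw] := qform_max S p0.
set l := qform S w in Hw.
pose h := S *m w - l *: w.
have hE : bform S h w - l * bform 1%:M h w = sqnorm h.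
  have -> : sqnorm h = bform 1%:M h (S *m w - l *: w) by [].
  by rewrite -(scaleNr l w) bformDr bformZr -bform_mulmx mulNr.
(* The form at w + t h, minus l |w + t h|^2, is 2 t |h|^2 - t^2 C. *)
pose C := l * sqnorm h - qform S h.
have C0 : 0 <= C by rewrite subr_ge0.
have key t : 2 * t * sqnorm h <= t ^+ 2 * C.
  have := Hw (w + t *: h); rewrite [sqnorm (w + _)]/sqnorm !qformD ?trmx1//.
  rewrite !qformZ -/(sqnorm w) -/(sqnorm h) w1 !bformZr (bformC w h symS).
  rewrite (bformC w h (trmx1 _ _)) -/l /C -hE; nra.
have h0 : h = 0.
  apply/eqP; apply: contraT => /sqnorm_gt0 h0.
  (* Any positive t below 2 |h|^2 / C would do. *)
  have := key (sqnorm h / (C + 1)); set s := sqnorm h in h0 *.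
  have C1 : 0 < C + 1 by rewrite ltr_wpDl.
  set q := s / (C + 1); have q0 : 0 < q by rewrite divr_gt0.
  have sq : s = q * (C + 1) by rewrite /q divfK// gt_eqF.
  by rewrite {1}sq; nra.
have wn0 : w != 0.
  by apply/eqP => w0; move: w1; rewrite w0 /sqnorm qform0 => /eqP; rewrite eq_sym oner_eq0.
have eig : eigenvalue S l.
  apply/eigenvalueP; exists w^T; last by rewrite trmx_eq0.
  rewrite -[in LHS]symS -trmx_mul -linearZ/=; congr trmx.
  by apply/eqP; rewrite -subr_eq0 -/h h0.
suff le_l : l <= lambda_max S.
  by move=> u; rewrite (le_trans (Hw u))// ler_wpM2r// sqnorm_ge0.
apply: ub_le_sup => //; exists l => a /eigenvalueP[x xS x0].
have := Hw x^T; rewrite /qform trmxK xS -scalemxAl mxE.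
have -> : (x *m x^T) ord0 ord0 = sqnorm x^T by rewrite /sqnorm /qform trmxK mulmx1.
by rewrite ler_pM2r// sqnorm_gt0// trmx_eq0.
Qed.

End sphere.
End quadratic_forms.

(** * The contraction constant *)

Section contraction_constants.
Context {R : realType} {p n : nat}.
Variables (X : 'M[R]_(n, p)) (Q : 'M[R]_p) (l : R).
Hypothesis Qpd : posdef Q.
Hypothesis l0 : 0 < l.
Hypothesis Xl : forall s, qform (X *m invmx Q *m X^T) s <= l * sqnorm s.

Lemma sqnorm_mulmx u : sqnorm (X *m u) = qform (X^T *m X) u.
Proof. by rewrite -[X^T]mulmx1 qform_congruence. Qed.

Lemma posdef_Sigma : posdef (Sigma X Q).
Proof.
have [symQ Q0] := Qpd; split.
  by rewrite /Sigma linearD/= trmx_mul trmxK symQ.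
move=> u u0; rewrite qformE bformDS -!qformE -sqnorm_mulmx.
by rewrite ltr_wpDl ?sqnorm_ge0// Q0.
Qed.

(** A form of the Cauchy-Schwarz inequality: expand the nonnegative value of Q
    at l u - Q^-1 X^T X u. *)
Lemma sqnorm_le_prior u : sqnorm (X *m u) <= l * qform Q u.
Proof.
have [symQ _] := Qpd; have Qu := posdef_unitmx Qpd.
pose a := invmx Q *m (X^T *m (X *m u)).
have ua : bform Q u a = sqnorm (X *m u).
  rewrite bform_mulmx mulKVmx// sqnorm_mulmx /qform /bform mulmx1.
  by rewrite !mulmxA.
have aa : qform Q a = qform (X *m invmx Q *m X^T) (X *m u).
  rewrite qformE bform_mulmx mulKVmx// /bform /qform mulmx1 trmx_mul.
  by rewrite trmx_inv symQ trmx_mul trmxK !mulmxA.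
have := posdef_ge0 (l *: u - a) Qpd.
rewrite qformB// qformZ bformZl ua aa => h.
have := Xl (X *m u) => h'.
have : l * sqnorm (X *m u) <= l * (l * qform Q u) by nra.
by rewrite ler_pM2l.
Qed.

Definition rate := l / (1 + l).

Lemma rate_gt0 : 0 < rate. Proof. by rewrite divr_gt0// addr_gt0. Qed.
Lemma rate_lt1 : rate < 1.
Proof. by rewrite ltr_pdivrMr ?addr_gt0// mul1r ltrDr. Qed.

Lemma sqnorm_le_Sigma u : sqnorm (X *m u) <= rate * qform (Sigma X Q) u.
Proof.
rewrite [qform (Sigma _ _) _]qformE bformDS -!qformE -sqnorm_mulmx.
rewrite /rate mulrAC ler_pdivlMr ?addr_gt0//.
have := sqnorm_le_prior u; nra.
Qed.

(** Let u = S^-1 X^T d. Then u^T S u = X u . d, and |X u - r d|^2 >= 0 together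
    with |X u|^2 <= r u^T S u gives r u^T S u <= r^2 |d|^2. *)
Lemma qform_Sigma_mean (d : 'cV[R]_n) :
  qform (Sigma X Q) (invmx (Sigma X Q) *m (X^T *m d)) <= rate * sqnorm d.
Proof.
set u := _ *m _; have Su := posdef_unitmx posdef_Sigma.
have uE : qform (Sigma X Q) u = bform 1%:M (X *m u) d.
  by rewrite qformE bform_mulmx mulKVmx// /bform !trmx_mul !mulmx1 !mulmxA.
have := sqnorm_le_Sigma u; have := sqnorm_ge0 (X *m u - rate *: d).
rewrite /sqnorm qformB ?trmx1// qformZ bformZr -uE => h1 h2.
have r0 := rate_gt0.
have : rate * qform (Sigma X Q) u <= rate * (rate * qform 1%:M d) by nra.
by rewrite ler_pM2l.
Qed.

End contraction_constants.

(** * Probabilities given by unnormalised densities *)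

Section densities.
Context {R : realType} {p : nat}.
Local Notation lam := (@lebesgue_tuple R p).
Implicit Types (w : p.-tuple R -> R).

Definition proper_weight w := [/\ measurable_fun [set: p.-tuple R] w,
  forall t, 0 <= w t, (0 < \int[lam]_t (w t)%:E)%E & (\int[lam]_t (w t)%:E < +oo)%E].

Definition weight_mass w : R := fine (\int[lam]_t (w t)%:E)%E.

Lemma weight_massK w : proper_weight w ->
  (weight_mass w)%:E = (\int[lam]_t (w t)%:E)%E.
Proof. by move=> [_ _ w0 woo]; rewrite fineK// ge0_fin_numE// ltW. Qed.

Lemma weight_mass_gt0 w : proper_weight w -> 0 < weight_mass w.
Proof. by move=> [_ _ w0 woo]; rewrite fine_gt0// w0 woo. Qed.

Let density0 w : density_prob w set0 = 0%E.
Proof. by rewrite /density_prob integral_set0 mul0e. Qed.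

Let density_ge0 w A : proper_weight w -> (0 <= density_prob w A)%E.
Proof.
move=> wp; have [_ w0 _ _] := wp; rewrite mule_ge0 ?integral_ge0//.
  by move=> t _; rewrite lee_fin.
by rewrite lee_fin invr_ge0 ltW// weight_mass_gt0.
Qed.

Let density_additive w : proper_weight w -> semi_sigma_additive (density_prob w).
Proof.
move=> wp; have [mw w0 _ _] := wp; move=> F mF tF mUF.
have c0 : 0 <= (weight_mass w)^-1 by rewrite invr_ge0 ltW// weight_mass_gt0.
rewrite /density_prob ge0_integral_bigcup//; last 2 first.
- by apply/measurable_EFinP/measurable_funTS.
- by move=> t _; rewrite lee_fin.
rewrite muleC -nneseriesZl//; last first.
  by move=> i _; apply: integral_ge0 => t _; rewrite lee_fin.
under eq_fun do under eq_bigr do rewrite muleC.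
apply: is_cvg_ereal_nneg_natsum_cond => i _ _; rewrite mule_ge0//.
by apply: integral_ge0 => t _; rewrite lee_fin.
Qed.

Let density_setT w : proper_weight w -> density_prob w setT = 1%E.
Proof.
move=> wp; rewrite /density_prob -weight_massK// -EFinM divff//.
by rewrite gt_eqF// weight_mass_gt0.
Qed.

Lemma density_probability w : proper_weight w ->
  exists P : probability (p.-tuple R) R, (P : set (p.-tuple R) -> \bar R) = density_prob w.
Proof.
move=> wp; pose m := isMeasure.Build _ _ _ (density_prob w) (density0 w)
  (fun A => density_ge0 A wp) (density_additive wp).
pose mu : {measure set (p.-tuple R) -> \bar R} := HB.pack (density_prob w) m.
pose pr := Measure_isProbability.Build _ _ _ mu (density_setT wp).
pose P : probability (p.-tuple R) R := HB.pack (Measure.sort mu) (Measure.class mu) pr.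
by exists P.
Qed.

Lemma ge0_integral_density_prob w (f : p.-tuple R -> \bar R) : proper_weight w ->
  measurable_fun [set: p.-tuple R] f -> (forall t, 0 <= f t)%E ->
  (\int[density_prob w]_t f t =
   (\int[lam]_t (f t * (w t)%:E)) * ((weight_mass w)^-1)%:E)%E.
Proof.
move=> wp mf f0; have [mw w0 _ _] := wp; have [P PE] := density_probability wp.
have c0 : 0 <= (weight_mass w)^-1 by rewrite invr_ge0 ltW// weight_mass_gt0.
rewrite -PE -ge0_integralZr//; last 2 first.
- by apply: emeasurable_funM => //; exact/measurable_EFinP.
- by move=> t _; rewrite mule_ge0// lee_fin.
rewrite (@ge0_integral_density _ _ _ lam P (fun t => w t / weight_mass w))//.
- by apply: eq_integral => t _; rewrite EFinM muleA.
- exact: measurable_funM.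
- by move=> t; rewrite mulr_ge0.
- move=> A mA; transitivity (density_prob w A); first by rewrite -PE.
  rewrite /density_prob -ge0_integralZr//.
  + by apply/measurable_EFinP/measurable_funTS.
  + by move=> t _; rewrite lee_fin.
Qed.

End densities.

(** * Gaussian weights *)

Section gaussian.
Context {R : realType}.

Lemma lebesgue_tuple_setT_neq0 p : @lebesgue_tuple R p [set: p.-tuple R] != 0%E.
Proof.
have I q : @lebesgue_tuple R q [set: q.-tuple R] =
    (\int[@lebesgue_tuple R q]_t (cst 1%E) t)%E.
  by rewrite integral_cst// mul1e.
elim: p => [|p IH]; first by rewrite /lebesgue_tuple/= diracT onee_eq0.
have pos : (0 < \int[@lebesgue_tuple R p]_t (cst 1%E) t)%E.
  by apply: integral_gt0.
have e := @ge0_integral_tprodS R p (fun=> leb) (cst 1%E) (measurable_cst _)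
  (fun=> lee01).
have lebT : leb [set: R] != 0%E.
  by rewrite /leb -set_itvNyy lebesgue_measure_itv.
have posS : (0 < \int[@leb R]_x cst (\int[@lebesgue_tuple R p]_t cst 1 t) x)%E.
  apply: integral_gt0; [exact: measurableT|exact: measurable_cst| |exact: lebT].
  by move=> x _; exact: pos.
have h : (0 < \int[@lebesgue_tuple R p.+1]_t cst 1 t)%E.
  by rewrite [ltRHS]e; exact: posS.
by rewrite I (gt_eqF h).
Qed.

Let eq_leE (x y : \bar R) : x = y -> (x <= y)%E. Proof. by move=> ->. Qed.

Lemma integral_prod_tnth_lty p (g : R -> R) :
  measurable_fun [set: R] g -> (forall x, 0 <= g x) ->
  (\int[@leb R]_x (g x)%:E < +oo)%E ->
  (\int[@lebesgue_tuple R p]_t (\prod_(i < p) g (tnth t i))%:E < +oo)%E.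
Proof.
move=> mg g0 goo.
have mprod q : measurable_fun [set: q.-tuple R]
    (fun t => (\prod_(i < q) g (tnth t i))%:E).
  by apply/measurable_EFinP; exact: (@measurable_prod_tnth _ _ (fun=> g)).
have prod0 q (t : q.-tuple R) : (0 <= (\prod_(i < q) g (tnth t i))%:E)%E.
  by rewrite lee_fin prodr_ge0.
elim: p => [|p IH].
  have e := @ge0_integral_tprod0 R (fun=> leb) _ (prod0 0%N).
  by apply: (le_lt_trans (eq_leE e)); rewrite big_ord0 ltry.
have e := @ge0_integral_tprodS R p (fun=> leb) _ (mprod p.+1) (prod0 p.+1).
pose c := (\int[@lebesgue_tuple R p]_t (\prod_(i < p) g (tnth t i))%:E)%E.
have c0 : (0 <= c)%E by apply: integral_ge0 => t _; exact: prod0.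
apply: (@le_lt_trans _ _ (\int[@leb R]_x ((g x)%:E * c))%E).
  apply: (@le_trans _ _ _ _ _ (eq_leE e)); apply: eq_leE.
  apply: eq_integral => x _.
  rewrite -ge0_integralZl; [|exact: measurableT|exact: mprod
    |by move=> t _; exact: prod0|by rewrite lee_fin].
  apply: eq_integral => t _; rewrite big_ord_recl tnth0 -EFinM.
  by congr (_ * _)%:E; apply: eq_bigr => i _; rewrite tnthS.
rewrite ge0_integralZr//; last 2 first.
- exact/measurable_EFinP.
- by move=> x _; rewrite lee_fin.
rewrite lte_mul_pinfty// ?integral_ge0//.
- by move=> x _; rewrite lee_fin.
- by rewrite ge0_fin_numE// integral_ge0// => x _; rewrite lee_fin.
Qed.

(** The integrand is a multiple of the density of a centred normal law of
    variance 1 / (2 c). *)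
Lemma integral_gauss1_lty (c : R) : 0 < c ->
  (\int[@leb R]_x (expR (- (c * x ^+ 2)))%:E < +oo)%E.
Proof.
move=> c0; pose s := Num.sqrt (2 * c)^-1.
have s2 : s ^+ 2 = (2 * c)^-1 by rewrite sqr_sqrtr// invr_ge0 mulr_ge0// ltW.
have s0 : s != 0 by rewrite gt_eqF// sqrtr_gt0 invr_gt0 mulr_gt0.
have E x : expR (- (c * x ^+ 2)) = (normal_peak s)^-1 * normal_pdf 0 s x.
  rewrite normal_pdfE// mulKf ?gt_eqF ?normal_peak_gt0//.
  rewrite /normal_fun subr0 s2; congr expR.
  by field; rewrite gt_eqF.
have mpdf : measurable_fun [set: R] (fun x => (normal_pdf 0 s x)%:E).
  by apply/measurable_EFinP; exact: measurable_normal_pdf.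
under eq_integral do rewrite E EFinM.
rewrite ge0_integralZl//; last 2 first.
- by move=> x _; rewrite lee_fin normal_pdf_ge0.
- by rewrite lee_fin invr_ge0 normal_peak_ge0.
rewrite ge0_integral_leb//; last by move=> x; rewrite lee_fin normal_pdf_ge0.
by rewrite integral_normal_pdf mule1 ltry.
Qed.

Section on_tuples.
Context {p : nat}.
Local Notation lam := (@lebesgue_tuple R p).
Implicit Types (S : 'M[R]_p) (m : 'cV[R]_p) (t : p.-tuple R).

Lemma measurable_qform_colv S m :
  measurable_fun [set: p.-tuple R] (fun t => qform S (colv t - m)).
Proof.
have mt i : measurable_fun [set: p.-tuple R] (fun t => (colv t - m) i ord0).
  under eq_fun do rewrite !mxE.
  by apply: measurable_funB => //; exact: measurable_tnth.
under eq_fun do rewrite qform_sum.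
apply: measurable_sum => i; apply: measurable_sum => j.
by apply: measurable_funM => //; exact: measurable_funM.
Qed.

Definition gauss S m t : R := expR (- (2^-1 * qform S (colv t - m))).

Lemma measurable_gauss S m : measurable_fun [set: p.-tuple R] (gauss S m).
Proof.
apply: measurableT_comp => //; apply: measurableT_comp => //.
by apply: measurable_funM => //; exact: measurable_qform_colv.
Qed.

Lemma gauss_gt0 S m t : 0 < gauss S m t. Proof. exact: expR_gt0. Qed.

Lemma gauss_shift S m m' t : gauss S m (shift_tuple m' t) = gauss S (m - m') t.
Proof. by rewrite /gauss colv_shift opprB addrA addrAC. Qed.

Lemma integral_gauss S m :
  (\int[lam]_t (gauss S m t)%:E = \int[lam]_t (gauss S 0 t)%:E)%E.
Proof.
rewrite (ge0_integral_lebesgue_tuple_shift m).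
- by apply: eq_integral => t _; rewrite gauss_shift subrr.
- by apply/measurable_EFinP; exact: measurable_gauss.
- by move=> t; rewrite lee_fin ltW// gauss_gt0.
Qed.

(** By [qform_dominated] the weight is at most a product of one-dimensional
    Gaussian weights. *)
Lemma gauss_proper S m : posdef S -> proper_weight (gauss S m).
Proof.
move=> Spd; split.
- exact: measurable_gauss.
- by move=> t; rewrite ltW// gauss_gt0.
- apply: integral_gt0 => //.
  + by apply/measurable_EFinP; exact: measurable_gauss.
  + by move=> t _; rewrite lte_fin gauss_gt0.
  + exact: lebesgue_tuple_setT_neq0.
- have [k k0 Hk] := qform_dominated 1%:M Spd.
  rewrite integral_gauss; pose c := (2 * k)^-1.
  have c0 : 0 < c by rewrite invr_gt0 mulr_gt0.
  have mg : measurable_fun [set: R] (fun x => expR (- (c * x ^+ 2))).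
    apply: measurableT_comp => //; apply: measurableT_comp => //.
    by apply: measurable_funM => //; exact: measurable_funX.
  apply: le_lt_trans (integral_prod_tnth_lty p mg _ (integral_gauss1_lty c0));
    last by move=> x; exact: expR_ge0.
  apply: ge0_le_integral => //.
  + by move=> t _; rewrite lee_fin ltW// gauss_gt0.
  + by apply/measurable_EFinP; exact: measurable_gauss.
  + apply/measurable_EFinP; exact: (@measurable_prod_tnth _ p (fun=> _) (fun=> mg)).
  + move=> t _; rewrite lee_fin -expR_sum ler_expR sumrN lerN2 -mulr_sumr.
    have := Hk (colv t - 0); rewrite -/(sqnorm _) sqnormE subr0.
    under eq_bigr do rewrite mxE.
    move=> h; rewrite /c ler_pdivrMl ?mulr_gt0//.
    have -> : 2 * k * (2^-1 * qform S (colv t)) = k * qform S (colv t) by field.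
    exact: h.
Qed.

End on_tuples.
End gaussian.

Section gaussian_estimates.
Context {R : realType} {p : nat}.
Local Notation lam := (@lebesgue_tuple R p).
Implicit Types (S : 'M[R]_p) (m : 'cV[R]_p) (t : p.-tuple R).

Let mEgauss S m : measurable_fun [set: p.-tuple R] (fun t => (gauss S m t)%:E).
Proof. by apply/measurable_EFinP; exact: measurable_gauss. Qed.

Let gauss_ge0 S m t : 0 <= gauss S m t. Proof. exact/ltW/gauss_gt0. Qed.

(** With q the value of S, q exp(- q / 2) <= 4 exp(- q / 4), and the right-hand
    side is again a Gaussian weight. *)
Lemma gauss_moment_lty S S' m : posdef S -> (forall u, 0 <= qform S' u) ->
  (\int[lam]_t (qform S' (colv t - m) * gauss S m t)%:E < +oo)%E.
Proof.
move=> Spd S'0; have [k k0 Hk] := qform_dominated S' Spd.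
have halfpd : posdef (2^-1 *: S).
  have [symS S0] := Spd; split; first by rewrite linearZ/= symS.
  move=> u u0; rewrite /qform -scalemxAr -scalemxAl mxE.
  by rewrite mulr_gt0// S0.
have [_ _ _ fin] := gauss_proper m halfpd.
apply: (@le_lt_trans _ _ (\int[lam]_t ((4 * k)%:E * (gauss (2^-1 *: S) m t)%:E))%E).
  apply: ge0_le_integral => //.
  - by move=> t _; rewrite lee_fin mulr_ge0.
  - apply/measurable_EFinP/measurable_funM; last exact: measurable_gauss.
    exact: measurable_qform_colv.
  - by apply: emeasurable_funM.
  - move=> t _; rewrite -EFinM lee_fin /gauss.
    have -> : qform (2^-1 *: S) (colv t - m) = 2^-1 * qform S (colv t - m).
      by rewrite /qform -scalemxAr -scalemxAl mxE.
    have := Hk (colv t - m); set q' := qform S' _; set q := qform S _ => h.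
    have -> : - (2^-1 * q) = - (4^-1 * q) + - (2^-1 * (2^-1 * q)) by field.
    rewrite expRD mulrA ler_wpM2r ?expR_ge0// expRN ler_pdivrMr ?expR_gt0//.
    have := expR_ge1Dx (4^-1 * q); nra.
rewrite ge0_integralZl//; last 2 first.
- by move=> t _; rewrite lee_fin.
- by rewrite lee_fin mulr_ge0// ltW.
by rewrite lte_mul_pinfty// lee_fin mulr_ge0// ltW.
Qed.

(** Let g and g' be the two weights and d the S-distance of the centres. By the
    parallelogram identity, sqrt (g g') is exp(- d^2 / 8) times the weight centred
    at the midpoint, which has the same integral Z; hence the integral of
    (sqrt g - sqrt g')^2 is at most Z d^2 / 4. The difference
    g - g' = (sqrt g - sqrt g') (sqrt g + sqrt g') is bounded by
    (sqrt g - sqrt g')^2 / (2 d) + d (g + g'), whose integral is of order d. *)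
Lemma gauss_diff_le S m m' (A : set (p.-tuple R)) : posdef S -> measurable A ->
  (\int[lam]_(t in A) (gauss S m t)%:E <=
   \int[lam]_(t in A) (gauss S m' t)%:E +
   (3 * Num.sqrt (qform S (m - m')) * weight_mass (gauss S 0))%:E)%E.
Proof.
move=> Spd mA; have [symS S0] := Spd.
have Z0 := weight_mass_gt0 (gauss_proper 0 Spd).
set Z := weight_mass _ in Z0 *.
have ZE c : (\int[lam]_t (gauss S c t)%:E = Z%:E)%E.
  by rewrite integral_gauss weight_massK//; exact: gauss_proper.
have [->|mm'] := eqVneq m m'.
  by rewrite subrr qform0 sqrtr0 mulr0 mul0r adde0.
have d20 : 0 < qform S (m - m') by rewrite S0// subr_eq0.
set d := Num.sqrt _; have d0 : 0 < d by rewrite sqrtr_gt0.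
have d2 : d ^+ 2 = qform S (m - m') by rewrite sqr_sqrtr// ltW.
(* E is the ratio between sqrt (g g') and the weight centred at mid. *)
pose mid := 2^-1 *: (m + m'); pose E := expR (- (d ^+ 2 / 8)).
have prodE t : gauss S mid t * E = expR (- (4^-1 * qform S (colv t - m))) *
    expR (- (4^-1 * qform S (colv t - m'))).
  rewrite /gauss /E -!expRD; congr expR; rewrite d2.
  have -> : colv t - m = (colv t - mid) - 2^-1 *: (m - m').
    by apply/colP => i; rewrite !mxE; field.
  have -> : colv t - m' = (colv t - mid) + 2^-1 *: (m - m').
    by apply/colP => i; rewrite !mxE; field.
  by move: (colv t - mid) (m - m') => x z; rewrite qformB// qformD// qformZ; field.
(* This is (sqrt g - sqrt g')^2 / (2 d) + d (g + g'). *)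
pose h t := (2 * d)^-1 * (gauss S m t + gauss S m' t - 2 * (gauss S mid t * E))
  + d * (gauss S m t + gauss S m' t).
have sq c t : gauss S c t = expR (- (4^-1 * qform S (colv t - c))) ^+ 2.
  by rewrite /gauss expr2 -expRD; congr expR; field.
have h0 t : 0 <= h t.
  rewrite /h; apply: addr_ge0; apply: mulr_ge0; [|idtac|exact: ltW|exact: addr_ge0].
    by rewrite invr_ge0 mulr_ge0// ltW.
  rewrite prodE !sq; set a := expR _; set b := expR _.
  by have := sqr_ge0 (a - b); nra.
have le_h t : gauss S m t <= gauss S m' t + h t.
  rewrite /h prodE !sq; set a := expR _; set b := expR _.
  rewrite -subr_ge0.
  have -> : b ^+ 2 + ((2 * d)^-1 * (a ^+ 2 + b ^+ 2 - 2 * (a * b)) +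
      d * (a ^+ 2 + b ^+ 2)) - a ^+ 2 =
    (2 * d)^-1 * (a - b - d * (a + b)) ^+ 2 + 2^-1 * d * (a - b) ^+ 2.
    by field; rewrite gt_eqF.
  by rewrite addr_ge0// mulr_ge0 ?sqr_ge0// ?invr_ge0 ?mulr_ge0// ltW.
have mh : measurable_fun [set: p.-tuple R] (fun t => (h t)%:E).
  apply/measurable_EFinP; apply: measurable_funD; apply: measurable_funM => //.
    apply: measurable_funB; first by apply: measurable_funD; exact: measurable_gauss.
    apply: measurable_funM => //; apply: measurable_funM => //.
    exact: measurable_gauss.
  by apply: measurable_funD; exact: measurable_gauss.
have inth : (\int[lam]_t (h t)%:E <= (3 * d * Z)%:E)%E.
  have sum : (\int[lam]_t (h t)%:E + (d^-1 * E * Z)%:E =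
      (((2 * d)^-1 + d) * (Z + Z))%:E)%E.
    have k0 : 0 <= d^-1 * E by rewrite mulr_ge0 ?expR_ge0// invr_ge0 ltW.
    have k1 : 0 <= (2 * d)^-1 + d.
      by rewrite addr_ge0 ?invr_ge0 ?mulr_ge0// ltW.
    have L1 : (\int[lam]_t ((d^-1 * E) * gauss S mid t)%:E = (d^-1 * E * Z)%:E)%E.
      under eq_integral do rewrite EFinM.
      rewrite ge0_integralZl ?ZE -?EFinM ?lee_fin//.
      by move=> t _; rewrite lee_fin.
    have R1 : (\int[lam]_t (((2 * d)^-1 + d) * (gauss S m t + gauss S m' t))%:E =
        (((2 * d)^-1 + d) * (Z + Z))%:E)%E.
      under eq_integral do rewrite EFinM (EFinD (gauss _ _ _)).
      rewrite ge0_integralZl ?lee_fin//; last 2 first.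
      - by apply: emeasurable_funD; exact: mEgauss.
      - by move=> t _; rewrite -EFinD lee_fin addr_ge0.
      rewrite ge0_integralD ?ZE -?EFinD -?EFinM//.
      - by move=> t _; rewrite lee_fin.
      - by move=> t _; rewrite lee_fin.
    rewrite -L1 -R1 -ge0_integralD; last 5 first.
    - exact: measurableT.
    - by move=> t _; rewrite lee_fin.
    - exact: mh.
    - by move=> t _; rewrite lee_fin mulr_ge0.
    - apply/measurable_EFinP; apply: measurable_funM; first exact: measurable_cst.
      exact: measurable_gauss.
    apply: eq_integral => t _; rewrite -EFinD; congr EFin.
    by rewrite /h; field; rewrite gt_eqF.
  have fin : (\int[lam]_t (h t)%:E)%E \is a fin_num.
    rewrite ge0_fin_numE; last by apply: integral_ge0 => t _; rewrite lee_fin.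
    rewrite (@le_lt_trans _ _ (((2 * d)^-1 + d) * (Z + Z))%:E) ?ltry// -sum leeDl//.
    by rewrite lee_fin !mulr_ge0 ?expR_ge0// ?invr_ge0 ltW.
  have Zn : 0 <= Z by exact: ltW.
  have sumE : fine (\int[lam]_t (h t)%:E)%E + d^-1 * E * Z =
      ((2 * d)^-1 + d) * (Z + Z).
    by apply: EFin_inj; rewrite EFinD fineK.
  rewrite -(fineK fin) lee_fin.
  have : 1 + - (d ^+ 2 / 8) <= E by exact: expR_ge1Dx.
  move: sumE; set I := fine _ => sumE E1.
  have -> : I = Z * (d^-1 * (1 - E) + 2 * d).
    have -> : I = ((2 * d)^-1 + d) * (Z + Z) - d^-1 * E * Z by rewrite -sumE addrK.
    by field; rewrite gt_eqF.
  rewrite [leRHS]mulrC ler_wpM2l//.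
  have : d^-1 * (1 - E) <= d^-1 * (d ^+ 2 / 8).
    by apply: ler_wpM2l; [rewrite invr_ge0 ltW|lra].
  have -> : d^-1 * (d ^+ 2 / 8) = d / 8 by field; rewrite gt_eqF.
  by lra.
have lt0 c t : A t -> (0 <= (gauss S c t)%:E)%E by rewrite lee_fin.
have mgA c : measurable_fun A (fun t => (gauss S c t)%:E) by exact: measurable_funTS.
apply: (@le_trans _ _ (\int[lam]_(t in A) ((gauss S m' t)%:E + (h t)%:E))%E).
  apply: ge0_le_integral; [exact: mA|exact: lt0|exact: mgA| |].
  - by apply: emeasurable_funD; [exact: mgA|exact: measurable_funTS].
  - by move=> t _; rewrite -EFinD lee_fin.
rewrite ge0_integralD; [|exact: mA|exact: lt0|exact: mgA
  |by move=> t _; rewrite lee_fin|exact: measurable_funTS].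
apply: leeD2l; apply: (le_trans _ inth).
apply: ge0_subset_integral; [exact: mA|exact: measurableT|exact: mh| |exact: subsetT].
by move=> t _; rewrite lee_fin.
Qed.

Lemma multinormalE m S (A : set (p.-tuple R)) :
  multinormal m (invmx S) A = density_prob (gauss S m) A.
Proof. by rewrite /multinormal invmxK. Qed.

(** Translation invariance of Lebesgue measure: a normal vector is its mean plus
    centred noise. *)
Lemma multinormal_shift m S (A : set (p.-tuple R)) : measurable A ->
  multinormal m (invmx S) A = multinormal 0 (invmx S) (shift_tuple m @^-1` A).
Proof.
move=> mA.
rewrite (multinormalE m S A) (multinormalE 0 S).
rewrite /density_prob (integral_gauss S m).
suff -> : (\int[lam]_(t in A) (gauss S m t)%:E =
  \int[lam]_(t in shift_tuple m @^-1` A) (gauss S 0 t)%:E)%E by [].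
have mA' : measurable (shift_tuple m @^-1` A).
  by rewrite -[X in measurable X]setTI; exact: measurable_shift_tuple.
rewrite [LHS]integral_mkcond [RHS]integral_mkcond.
rewrite (ge0_integral_lebesgue_tuple_shift m).
- apply: eq_integral => t _; rewrite !patchE gauss_shift subrr.
  by have -> : (t \in shift_tuple m @^-1` A) = (shift_tuple m t \in A) by [].
- by apply/(measurable_restrictT _ mA); apply: measurable_funTS; exact: mEgauss.
- by move=> t; rewrite patchE; case: ifPn => // _; rewrite lee_fin.
Qed.

Lemma multinormal_diff_le m m' S (A : set (p.-tuple R)) : posdef S -> measurable A ->
  (multinormal m (invmx S) A <= multinormal m' (invmx S) A +
    (3 * Num.sqrt (qform S (m - m')))%:E)%E.
Proof.
move=> Spd mA; rewrite (multinormalE m S A) (multinormalE m' S A).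
rewrite /density_prob.
rewrite (integral_gauss S m).
rewrite (integral_gauss S m').
have Z0 := weight_mass_gt0 (gauss_proper 0 Spd).
rewrite -/(weight_mass (gauss S 0)); set Z := weight_mass _ in Z0 *.
rewrite (@le_trans _ _ ((\int[lam]_(t in A) (gauss S m' t)%:E +
   (3 * Num.sqrt (qform S (m - m')) * Z)%:E) * (Z^-1)%:E)%E)//.
  by rewrite lee_wpmul2r ?gauss_diff_le// lee_fin invr_ge0 ltW.
rewrite ge0_muleDl; last 2 first.
- by apply: integral_ge0 => t _; rewrite lee_fin.
- by rewrite lee_fin !mulr_ge0// ltW.
by rewrite -EFinM mulfK// gt_eqF.
Qed.

End gaussian_estimates.

(** * Convergence rates of contracting random maps *)

Section random_map_coupling.
Context {R : realType} {d d' : measure_display}.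
Context {T : measurableType d} {W : measurableType d'}.
Variables (P : probability W R) (F : T * W -> T).
Variables (K : T -> set T -> \bar R) (Pi : probability T R).
Variables (c : T -> T -> R) (rho : R).
Hypothesis mF : measurable_fun [set: T * W] F.
Hypothesis KE : forall x A, measurable A -> K x A = P [set w | F (x, w) \in A].
Hypothesis invariant : forall A, measurable A -> (\int[Pi]_x K x A = Pi A)%E.
Hypothesis mc : measurable_fun [set: T * T] (fun xx : T * T => c xx.1 xx.2).
Hypothesis c0 : forall x x', 0 <= c x x'.
Hypothesis rho0 : 0 <= rho.
Hypothesis contract : forall x x' w, c (F (x, w)) (F (x', w)) <= rho * c x x'.

Let mFsec x : measurable_fun [set: W] (fun w => F (x, w)).
Proof. exact: (measurableT_comp mF (pair1_measurable x)). Qed.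

Let KE' x A : measurable A -> K x A = P ((fun w => F (x, w)) @^-1` A).
Proof.
move=> mA; rewrite KE//; congr (P _).
by apply/seteqP; split=> w /=; rewrite inE.
Qed.

(** K x A is the noise probability of a section of a measurable set. *)
Lemma measurable_step A : measurable A -> measurable_fun [set: T] (fun x => K x A).
Proof.
move=> mA; under eq_fun do rewrite KE'//.
have mFA : measurable (F @^-1` A) by rewrite -[X in measurable X]setTI; exact: mF.
rewrite (_ : (fun x => _) = P \o xsection (F @^-1` A)).
  exact: measurable_fun_xsection.
by apply/funext => x /=; rewrite xsectionE.
Qed.

Let K_ge0 x A : measurable A -> (0 <= K x A)%E.
Proof. by move=> mA; rewrite KE'. Qed.

Let G (xw : (T * T) * W) : T * T := (F (xw.1.1, xw.2), F (xw.1.2, xw.2)).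

Let mG : measurable_fun [set: (T * T) * W] G.
Proof.
have mproj (g : T * T -> T) : measurable_fun [set: T * T] g ->
    measurable_fun [set: (T * T) * W] (fun xw => F (g xw.1, xw.2)).
  move=> mg; apply: (measurableT_comp (f := F) (g := fun xw => (g xw.1, xw.2)) mF).
  by apply: measurable_fun_pair => //; exact: (measurableT_comp mg measurable_fst).
by apply: measurable_fun_pair; exact: mproj.
Qed.

Lemma ge0_integral_marginal (ups : probability (T * T)%type R) (mu : set T -> \bar R)
    (g : T * T -> T) (f : T -> \bar R) :
  measurable_fun [set: T * T] g ->
  (forall A, measurable A -> ups (g @^-1` A) = mu A) ->
  measurable_fun [set: T] f -> (forall x, 0 <= f x)%E ->
  (\int[ups]_u f (g u) = \int[mu]_x f x)%E.
Proof.
move=> mg gE mf f0.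
rewrite -[LHS](@ge0_integral_pushforward _ _ _ _ R g mg ups setT f)//.
by apply: eq_integral_on_measurable => A mA; rewrite -gE.
Qed.

(** Move both coordinates by the random map with the same noise. *)
Let coupled_step (ups : probability (T * T)%type R) :
  exists ups' : probability (T * T)%type R,
    (forall A, measurable A -> ups' (fst @^-1` A) = \int[ups]_u K u.1 A /\
                               ups' (snd @^-1` A) = \int[ups]_u K u.2 A)%E /\
    (\int[ups']_u (c u.1 u.2)%:E <= rho%:E * \int[ups]_u (c u.1 u.2)%:E)%E.
Proof.
pose PP := [the probability _ R of (ups \x P)%E].
pose m0 := [the {measure set (T * T)%type -> \bar R} of pushforward PP G].
pose m := m0 mG.
have m1 : m setT = 1%E by rewrite /m/= /pushforward preimage_setT probability_setT.
pose pr := Measure_isProbability.Build _ _ _ m m1.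
pose ups' : probability (T * T)%type R := HB.pack (Measure.sort m) (Measure.class m) pr.
exists ups'; split.
- move=> A mA; split.
  + rewrite [LHS]/= /pushforward /product_measure1; apply: eq_integral => u _ /=.
    by rewrite KE' // xsectionE.
  + rewrite [LHS]/= /pushforward /product_measure1; apply: eq_integral => u _ /=.
    by rewrite KE' // xsectionE.
- have mEc : measurable_fun [set: T * T] (fun u => (c u.1 u.2)%:E).
    exact/measurable_EFinP.
  have -> : (\int[ups']_u (c u.1 u.2)%:E =
      \int[(ups \x P)%E]_xw (c (G xw).1 (G xw).2)%:E)%E.
    rewrite -(@ge0_integral_pushforward _ _ _ _ R G mG PP setT
      (fun u => (c u.1 u.2)%:E))//.
    by move=> u _; rewrite lee_fin.
  rewrite (fubini_tonelli1 (fun xw => (c (G xw).1 (G xw).2)%:E)); last 2 first.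
  + exact: (measurableT_comp mEc mG).
  + by move=> xw; rewrite lee_fin.
  rewrite -ge0_integralZl//; last by move=> u _; rewrite lee_fin.
  apply: ge0_le_integral => //.
  + by move=> u _; apply: integral_ge0 => w _; rewrite lee_fin.
  + apply: (measurable_fun_fubini_tonelli_F (m2 := P)
      (fun xw => (c (G xw).1 (G xw).2)%:E)).
      exact: (measurableT_comp mEc mG).
    by move=> xw; rewrite lee_fin.
  + by apply: emeasurable_funM.
  + move=> u _.
    apply: (@le_trans _ _ (\int[P]_w (rho * c u.1 u.2)%:E)%E).
      apply: ge0_le_integral => //.
      * by move=> w _; rewrite lee_fin.
      * by apply: (measurableT_comp mEc); exact: (measurableT_comp mG (pair1_measurable u)).
      * by move=> w _; rewrite lee_fin contract.
    rewrite integral_cst// [X in (_ * X <= _)%E](_ : _ = 1%E).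
      by rewrite mule1 EFinM.
    exact: probability_setT.
Qed.

(** Start from the product of the Dirac mass at b and Pi, and apply [coupled_step]
    m times; the second marginal stays equal to Pi by invariance. *)
Lemma contracting_coupling b m : exists ups : probability (T * T)%type R,
  coupling (mstep_law K m b) Pi ups /\
  (\int[ups]_u (c u.1 u.2)%:E <= (rho ^+ m)%:E * \int[Pi]_x (c b x)%:E)%E.
Proof.
have mEc : measurable_fun [set: T * T] (fun u => (c u.1 u.2)%:E).
  exact/measurable_EFinP.
elim: m => [|m [ups [cpl le]]].
  pose PP := [the probability (T * T)%type R of (\d_b \x Pi)%E].
  exists PP; split.
    move=> A mA; split.
    - rewrite -[RHS]mule1 -(probability_setT Pi).
      rewrite -(@product_measure1E _ _ T T R \d_b Pi A setT mA measurableT).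
      by congr (PP _); apply/seteqP; split=> -[x x'] //= [].
    - rewrite -[RHS]mul1e -(diracT R b).
      rewrite -(@product_measure1E _ _ T T R \d_b Pi setT A measurableT mA).
      by congr (PP _); apply/seteqP; split=> -[x x'] //= [].
  rewrite expr0 mul1e (fubini_tonelli1 (fun u : T * T => (c u.1 u.2)%:E))//.
    rewrite integral_dirac ?diracT ?mul1e//.
    apply: (measurable_fun_fubini_tonelli_F (m2 := Pi) (fun u : T * T => (c u.1 u.2)%:E)) => //.
    by move=> u; rewrite lee_fin.
  by move=> u; rewrite lee_fin.
have [ups' [mar le']] := coupled_step ups.
exists ups'; split.
  move=> A mA; have [E1 E2] := mar A mA; split.
  - rewrite E1 (@ge0_integral_marginal ups (mstep_law K m b) fst (fun x => K x A))//.
    + by move=> B mB; have [] := cpl B mB.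
    + exact: measurable_step.
    + by move=> x; exact: K_ge0.
  - rewrite E2 (@ge0_integral_marginal ups Pi snd (fun x => K x A))//.
    + exact: invariant.
    + by move=> B mB; have [] := cpl B mB.
    + exact: measurable_step.
    + by move=> x; exact: K_ge0.
rewrite (le_trans le')// exprS EFinM -muleA.
by apply: lee_wpmul2l => //; rewrite lee_fin.
Qed.

Hypothesis c_fin : forall b, (\int[Pi]_x (c b x)%:E < +oo)%E.

Let M b := fine (\int[Pi]_x (c b x)%:E)%E.

Let M0 b : 0 <= M b.
Proof. by apply: fine_ge0; apply: integral_ge0 => x _; rewrite lee_fin. Qed.

Let ME b : (M b)%:E = (\int[Pi]_x (c b x)%:E)%E.
Proof.
by rewrite fineK// ge0_fin_numE// integral_ge0// => x _; rewrite lee_fin.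
Qed.

Lemma rho_star_le (dist : (set T -> \bar R) -> (set T -> \bar R) -> \bar R) :
  geometric_rates dist K Pi rho -> rho_star dist K Pi <= rho.
Proof.
move=> rr; rewrite /rho_star; case: asboolP => [_|[]]; last by exists rho.
by apply: ge_inf => //; exists 0 => r [/andP[]].
Qed.

Hypothesis rho1 : rho <= 1.

Lemma wasserstein_rate : rho_star (wasserstein c) K Pi <= rho.
Proof.
apply: rho_star_le; split; first by rewrite rho0.
exists M; split => // m b _.
have [ups [cpl le]] := contracting_coupling b m.
apply: (@le_trans _ _ (\int[ups]_u (c u.1 u.2)%:E)%E).
  by apply: ereal_inf_lbound; exists ups.
by rewrite (le_trans le)// -ME -EFinM mulrC.
Qed.

(** Use the coupling up to time m and the regularity of K for step m + 1: the
    discrepancy is at most C times the mean distance at time m. The lost factor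
    rho goes into the constant. *)
Lemma total_variation_rate (C : R) : 0 < rho -> 0 <= C ->
  (forall x x' A, measurable A -> (K x A <= K x' A + (C * c x x')%:E)%E) ->
  (forall x x', c x x' = c x' x) ->
  rho_star tv_dist K Pi <= rho.
Proof.
move=> rho_gt0 C0 smooth cC; apply: rho_star_le; split; first by rewrite rho0.
exists (fun b => C * M b / rho); split => [b|m b].
  by rewrite divr_ge0// mulr_ge0.
case: m => // m _; apply: ge_ereal_sup => _ [A mA <-].
have mEc : measurable_fun [set: T * T] (fun u => (c u.1 u.2)%:E).
  exact/measurable_EFinP.
have [ups [cpl le]] := contracting_coupling b m.
have mK (g : T * T -> T) : measurable_fun [set: T * T] g ->
    measurable_fun [set: T * T] (fun u => K (g u) A).
  by move=> mg; apply: (measurableT_comp (measurable_step mA)).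
have E1 : mstep_law K m.+1 b A = (\int[ups]_u K u.1 A)%E.
  rewrite (@ge0_integral_marginal ups (mstep_law K m b) fst (fun x => K x A))//.
  - by move=> B mB; have [] := cpl B mB.
  - exact: measurable_step.
  - by move=> x; exact: K_ge0.
have E2 : Pi A = (\int[ups]_u K u.2 A)%E.
  rewrite (@ge0_integral_marginal ups Pi snd (fun x => K x A))//.
  - by rewrite invariant.
  - by move=> B mB; have [] := cpl B mB.
  - exact: measurable_step.
  - by move=> x; exact: K_ge0.
have le1 (g g' : T * T -> T) :
    measurable_fun [set: T * T] g -> measurable_fun [set: T * T] g' ->
    (forall u, c (g u) (g' u) = c u.1 u.2) ->
    (\int[ups]_u K (g u) A <= \int[ups]_u K (g' u) A + (C * M b * rho ^+ m)%:E)%E.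
  move=> mg mg' gg'.
  apply: (@le_trans _ _ (\int[ups]_u (K (g' u) A + C%:E * (c u.1 u.2)%:E))%E).
    apply: ge0_le_integral => //.
    - by move=> u _; exact: K_ge0.
    - exact: mK.
    - by apply: emeasurable_funD; [exact: mK|exact: emeasurable_funM].
    - by move=> u _; rewrite -EFinM -gg'; exact: smooth.
  rewrite ge0_integralD//; last 4 first.
  - by move=> u _; exact: K_ge0.
  - exact: mK.
  - by move=> u _; rewrite mule_ge0// lee_fin.
  - exact: emeasurable_funM.
  apply: leeD2l; rewrite ge0_integralZl//; last by move=> u _; rewrite lee_fin.
  rewrite -mulrA EFinM lee_wpmul2l ?lee_fin//.
  by rewrite (le_trans le)// -ME -EFinM mulrC.
have P1 x : (K x A <= 1)%E.
  rewrite KE'//; apply: probability_le1.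
  by rewrite -[X in measurable X]setTI; exact: mFsec.
have fin (g : T * T -> T) : measurable_fun [set: T * T] g ->
    (\int[ups]_u K (g u) A)%E \is a fin_num.
  move=> mg; rewrite ge0_fin_numE; last by apply: integral_ge0 => u _; exact: K_ge0.
  apply: (@le_lt_trans _ _ (\int[ups]_u (cst 1%E u))%E).
    apply: ge0_le_integral => //; first by move=> u _; exact: K_ge0.
    exact: mK.
  rewrite integral_cst// mul1e (le_lt_trans (probability_le1 _ _)) ?ltry//.
have h1 := le1 fst snd measurable_fst measurable_snd (fun=> erefl).
have h2 := le1 snd fst measurable_snd measurable_fst (fun=> cC _ _).
rewrite E1 E2; move: h1 h2; set I := (\int[ups]_u K u.1 A)%E.
set J := (\int[ups]_u K u.2 A)%E.
rewrite -(fineK (fin _ measurable_fst : I \is a fin_num)).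
rewrite -(fineK (fin _ measurable_snd : J \is a fin_num)).
rewrite -!EFinD !lee_fin => h1 h2.
have -> : C * M b / rho * rho ^+ m.+1 = C * M b * rho ^+ m.
  by rewrite exprS mulrA divfK// gt_eqF.
rewrite ler_norml; apply/andP; split; lra.
Qed.

End random_map_coupling.

(** * The chain as a random map *)

Section tprod_probability.
Context {R : realType}.
Local Notation sfm := {sigma_finite_measure set R -> \bar R}.

Lemma tprod_setT n (mu : 'I_n -> sfm) :
  (forall i, mu i [set: R] = 1%E) -> tprod mu [set: n.-tuple R] = 1%E.
Proof.
have I q (nu : 'I_q -> sfm) :
    (tprod nu [set: q.-tuple R] = \int[tprod nu]_t (cst 1 t))%E.
  by rewrite integral_cst// mul1e.
elim: n mu => [|n IH] mu mu1; first by rewrite /tprod/= diracT.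
rewrite I ge0_integral_tprodS//=.
under eq_integral => x _.
  have -> : (\int[tprod (fun i => mu (lift ord0 i))]_t 1 = 1)%E.
    by rewrite -[RHS](IH (fun i => mu (lift ord0 i))) ?I.
  over.
by rewrite integral_cst// mul1e; exact: mu1.
Qed.

End tprod_probability.

Section random_map.
Context {R : realType} {p n : nat}.
Variables (X : 'M[R]_(n, p)) (y : n.-tuple bool).
Variables (Q : 'M[R]_p) (v : 'cV[R]_p).
Hypothesis Qpd : posdef Q.

Local Notation S := (Sigma X Q).

Let Spd : posdef S. Proof. exact: posdef_Sigma. Qed.

Definition post_mean (z : n.-tuple R) : 'cV[R]_p :=
  invmx S *m (X^T *m colv z + Q *m v).

(** The latent vector drawn from b with uniform noise u. *)
Definition latent (b : p.-tuple R) (u : n.-tuple R) : n.-tuple R :=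
  coord_map (fun i x => trunc_quantile (tnth y i) (linpred X b i, x)) u.

(** The noise consists of n uniform variables and a centred normal vector. *)
Definition chain_map (bw : p.-tuple R * (n.-tuple R * p.-tuple R)) : p.-tuple R :=
  shift_tuple (post_mean (latent bw.1 bw.2.1)) bw.2.2.

Lemma measurable_mulmx_colv d (T : measurableType d) q r (A : 'M[R]_(r, q))
    (f : T -> q.-tuple R) i :
  measurable_fun [set: T] f ->
  measurable_fun [set: T] (fun x => (A *m colv (f x)) i ord0).
Proof.
move=> mf; under eq_fun do rewrite mxE.
apply: measurable_sum => j; apply: measurable_funM => //.
under eq_fun do rewrite mxE.
by move/measurable_fun_tnthP : mf; exact.
Qed.

Lemma measurable_shift_mean d (T : measurableType d) (z : T -> n.-tuple R)
    (w : T -> p.-tuple R) :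
  measurable_fun [set: T] z -> measurable_fun [set: T] w ->
  measurable_fun [set: T] (fun x => shift_tuple (post_mean (z x)) (w x)).
Proof.
move=> mz mw; apply/measurable_fun_tnthP => i.
rewrite (_ : _ \o _ = fun x => tnth (w x) i +
    ((invmx S *m X^T *m colv (z x)) i ord0 + (invmx S *m (Q *m v)) i ord0)).
  apply: measurable_funD; first by move/measurable_fun_tnthP : mw; exact.
  by apply: measurable_funD => //; exact: measurable_mulmx_colv.
apply/funext => x /=; rewrite tnth_mktuple; congr (_ + _).
by rewrite /post_mean mulmxDr mxE !mulmxA.
Qed.

Lemma measurable_latent d (T : measurableType d) (b : T -> p.-tuple R)
    (u : T -> n.-tuple R) :
  measurable_fun [set: T] b -> measurable_fun [set: T] u ->
  measurable_fun [set: T] (fun x => latent (b x) (u x)).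
Proof.
move=> mb mu; apply/measurable_fun_tnthP => i.
rewrite (_ : _ \o _ = fun x =>
    trunc_quantile (tnth y i) (linpred X (b x) i, tnth (u x) i)); last first.
  by apply/funext => x /=; rewrite tnth_mktuple.
apply: (measurableT_comp (measurable_trunc_quantile (tnth y i))).
apply: measurable_fun_pair; first exact: measurable_mulmx_colv.
by move/measurable_fun_tnthP : mu; exact.
Qed.

Lemma measurable_chain_map :
  measurable_fun [set: p.-tuple R * (n.-tuple R * p.-tuple R)] chain_map.
Proof.
apply: measurable_shift_mean.
  apply: measurable_latent => //.
  exact: (measurableT_comp measurable_fst measurable_snd).
exact: (measurableT_comp measurable_snd measurable_snd).
Qed.

Definition latent_law (b : p.-tuple R) : 'I_n -> {sigma_finite_measure set R -> \bar R} :=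
  fun i => trunc_normal (linpred X b i) (tnth y i).

Definition unifs : 'I_n -> {sigma_finite_measure set R -> \bar R} := fun=> unif01.

(** Inverse transform sampling, coordinate by coordinate. *)
Lemma ge0_integral_latent b (h : n.-tuple R -> \bar R) :
  measurable_fun [set: n.-tuple R] h -> (forall z, 0 <= h z)%E ->
  (\int[tprod (latent_law b)]_z h z = \int[tprod unifs]_u h (latent b u))%E.
Proof.
move=> mh h0.
rewrite (@ge0_integral_tprod_transform _ _ unifs (latent_law b)
  (fun i x => trunc_quantile (tnth y i) (linpred X b i, x)) (fun _ _ => 1)).
- by apply: eq_integral => u _; rewrite big1// mule1.
- move=> i.
  exact: (measurable_quantile1 (trunc_normal (linpred X b i) (tnth y i))).
- by move=> i; exact: measurable_cst.
- by move=> i x; exact: ler01.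
- move=> i g mg g0.
  have mq := measurable_quantile1 (trunc_normal (linpred X b i) (tnth y i)).
  under [RHS]eq_integral do rewrite mule1.
  rewrite -[RHS](ge0_integral_pushforward mq unif01 measurableT mg); last first.
    by move=> x _; exact: g0.
  apply: eq_integral_on_measurable => A mA.
  by rewrite -[LHS]quantile_law.
- exact: mh.
- exact: h0.
Qed.

Variable noise : probability (p.-tuple R) R.
Hypothesis noiseE : (noise : set (p.-tuple R) -> \bar R) = multinormal 0 (invmx S).

(** The conditional law of the new parameter given the latent vector z. *)
Definition cond_law (A : set (p.-tuple R)) (z : n.-tuple R) : \bar R :=
  multinormal (post_mean z) (invmx S) A.

Lemma multinormal_noise m (A : set (p.-tuple R)) : measurable A ->
  multinormal m (invmx S) A = noise (shift_tuple m @^-1` A).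
Proof. by move=> mA; rewrite multinormal_shift// noiseE. Qed.

Lemma measurable_cond_law A : measurable A -> measurable_fun [set: n.-tuple R] (cond_law A).
Proof.
move=> mA; have mB : measurable ((fun zw : n.-tuple R * p.-tuple R =>
    shift_tuple (post_mean zw.1) zw.2) @^-1` A).
  by rewrite -[X in measurable X]setTI; exact: measurable_shift_mean.
rewrite (_ : cond_law A = noise \o xsection ((fun zw : n.-tuple R * p.-tuple R =>
    shift_tuple (post_mean zw.1) zw.2) @^-1` A)).
  exact: measurable_fun_xsection.
by apply/funext => z; rewrite /cond_law/= multinormal_noise// xsectionE.
Qed.

Lemma cond_law_ge0 A z : measurable A -> (0 <= cond_law A z)%E.
Proof. by move=> mA; rewrite /cond_law multinormal_noise. Qed.

Lemma albert_chibE b A : measurable A ->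
  albert_chib X y Q v b A = (\int[tprod unifs]_u cond_law A (latent b u))%E.
Proof.
move=> mA; rewrite -ge0_integral_latent; [by []|exact: measurable_cond_law|].
by move=> z; exact: cond_law_ge0.
Qed.

Lemma albert_chib_random_map (unif : probability (n.-tuple R) R) b A :
  (unif : set (n.-tuple R) -> \bar R) = tprod unifs -> measurable A ->
  albert_chib X y Q v b A =
  (unif \x noise)%E [set w | chain_map (b, w) \in A].
Proof.
move=> unifE mA; rewrite albert_chibE//.
rewrite /product_measure1 unifE; apply: eq_integral => u _.
rewrite /cond_law multinormal_noise//=; congr (noise _).
by rewrite xsectionE; apply/seteqP; split=> w /=; rewrite inE.
Qed.

Variable l : R.
Hypothesis l0 : 0 < l.
Hypothesis Xl : forall s, qform (X *m invmx Q *m X^T) s <= l * sqnorm s.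

Let colB q (A B : 'cV[R]_q) i : (A - B) i ord0 = A i ord0 - B i ord0.
Proof. by rewrite !mxE. Qed.

Let sqr_le (x x' t t' m m' : R) : x = t -> x' = t' ->
  `|t - t'| <= `|m - m'| -> (x - x') ^+ 2 <= (m - m') ^+ 2.
Proof.
move=> -> -> tm; rewrite -[leLHS]real_normK ?num_real//.
by rewrite -[leRHS]real_normK ?num_real// lerXn2r ?nnegrE.
Qed.

(** The quantiles are 1-Lipschitz in the linear predictors. *)
Lemma latent_dist b b' u :
  sqnorm (colv (latent b u) - colv (latent b' u)) <= sqnorm (X *m (colv b - colv b')).
Proof.
rewrite !sqnormE; apply: ler_sum => i _.
have lat c : colv (latent c u) i ord0 =
    trunc_quantile (tnth y i) (linpred X c i, tnth u i).
  by rewrite mxE tnth_mktuple.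
rewrite mulmxBr (colB (colv (latent b u))) (colB (X *m colv b)).
by apply: (sqr_le (lat b) (lat b')); exact: trunc_quantile_lip.
Qed.

(* From here on the latent vector enters only through [latent_dist]. *)
Opaque latent.

Let post_meanB z z' : post_mean z - post_mean z' =
  invmx S *m (X^T *m (colv z - colv z')).
Proof.
rewrite /post_mean -mulmxBr; congr (_ *m _).
by rewrite mulmxBr opprD addrACA subrr addr0.
Qed.

Lemma post_mean_dist b b' u :
  Num.sqrt (qform S (post_mean (latent b u) - post_mean (latent b' u))) <=
  rate l * psi X Q b b'.
Proof.
have r0 := rate_gt0 l0.
rewrite post_meanB.
rewrite -[leRHS]ger0_norm; last by rewrite mulr_ge0 ?sqrtr_ge0// ltW.
rewrite -sqrtr_sqr ler_sqrt ?sqr_ge0// exprMn sqr_sqrtr; last exact: posdef_ge0.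
rewrite (le_trans (qform_Sigma_mean Qpd l0 Xl _))// expr2 -mulrA ler_pM2l//.
by rewrite (le_trans (latent_dist _ _ _))// sqnorm_le_Sigma.
Qed.

Let psi_shift z z' w :
  psi X Q (shift_tuple (post_mean z) w) (shift_tuple (post_mean z') w) =
  Num.sqrt (qform S (post_mean z - post_mean z')).
Proof. by rewrite /psi !colv_shift opprD addrACA subrr add0r. Qed.

Let eq_leR (a c : R) : a = c -> a <= c. Proof. by move=> ->. Qed.

(** The normal noise is common to both points and cancels. *)
Lemma chain_map_contract b b' w :
  psi X Q (chain_map (b, w)) (chain_map (b', w)) <= rate l * psi X Q b b'.
Proof.
have h := psi_shift (latent b w.1) (latent b' w.1) w.2.
exact: (le_trans (eq_leR h) (post_mean_dist b b' w.1)).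
Qed.

(** Given the uniform noise, both laws are normal with covariance S^-1, and the
    S-distance of their means is at most rate l * psi X Q b b'. *)
Lemma albert_chib_smooth (unif : probability (n.-tuple R) R) b b' A :
  (unif : set (n.-tuple R) -> \bar R) = tprod unifs -> measurable A ->
  (albert_chib X y Q v b A <=
   albert_chib X y Q v b' A + (3 * rate l * psi X Q b b')%:E)%E.
Proof.
move=> unifE mA; rewrite !albert_chibE// -unifE.
have mk c : measurable_fun [set: n.-tuple R] (fun u => cond_law A (latent c u)).
  by apply: (measurableT_comp (measurable_cond_law mA)); exact: measurable_latent.
have c0 : 0 <= 3 * rate l * psi X Q b b'.
  apply: mulr_ge0; last exact: sqrtr_ge0.
  by apply: mulr_ge0 => //; apply: ltW; exact: rate_gt0.
apply: (@le_trans _ _ (\int[unif]_u (cond_law A (latent b' u) +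
    cst (3 * rate l * psi X Q b b')%:E u))%E).
  apply: ge0_le_integral.
  - exact: measurableT.
  - by move=> u _; exact: cond_law_ge0.
  - exact: mk.
  - by apply: emeasurable_funD; [exact: mk|exact: measurable_cst].
  - move=> u _; rewrite /cond_law (le_trans (multinormal_diff_le _
      (post_mean (latent b' u)) Spd mA))//.
    by apply: leeD2l; rewrite lee_fin -mulrA ler_wpM2l// post_mean_dist.
rewrite ge0_integralD.
- by rewrite integral_cst// [X in (_ * X)%E](@probability_setT _ _ _ unif) mule1.
- exact: measurableT.
- by move=> u _; exact: cond_law_ge0.
- exact: mk.
- by move=> u _; rewrite lee_fin.
- exact: measurable_cst.
Qed.

End random_map.

(** * Invariance and moments of the posterior *)

Section invariance.
Context {R : realType} {p n : nat}.
Variables (X : 'M[R]_(n, p)) (y : n.-tuple bool).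
Variables (Q : 'M[R]_p) (v : 'cV[R]_p).
Hypothesis Qpd : posdef Q.

Local Notation S := (Sigma X Q).
Local Notation lamp := (@lebesgue_tuple R p).
Local Notation lamn := (@lebesgue_tuple R n).
Local Notation mean := (post_mean X Q v).

Let Spd : posdef S. Proof. exact: posdef_Sigma. Qed.

Definition likelihood (b : p.-tuple R) : R :=
  \prod_(i < n) half_line_mass (linpred X b i) (tnth y i).

Definition post_weight (b : p.-tuple R) : R := likelihood b * gauss Q v b.

Lemma posteriorE : posterior X y Q v = density_prob post_weight.
Proof.
rewrite /posterior; congr density_prob; apply/funext => b.
rewrite /post_weight /likelihood /gauss; congr (_ * _).
by apply: eq_bigr => i _; rewrite half_line_massE.
Qed.

Lemma measurable_Phi : measurable_fun [set: R] (@Phi R).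
Proof.
apply: nondecreasing_measurable; first exact: measurableT.
move=> s t st; apply: fine_le.
- exact: (fin_num_measure (normal_prob 0 1)).
- exact: (fin_num_measure (normal_prob 0 1)).
- by apply: le_measure; rewrite ?inE//; exact: subset_itvl.
Qed.

Lemma measurable_half_line_mass a :
  measurable_fun [set: R] (fun m : R => half_line_mass m a).
Proof.
under eq_fun do rewrite half_line_massE.
apply: measurable_funM; apply: measurable_funX; first exact: measurable_Phi.
by apply: measurable_funB => //; exact: measurable_Phi.
Qed.

Lemma measurable_linpred i :
  measurable_fun [set: p.-tuple R] (fun b => linpred X b i).
Proof. exact: measurable_mulmx_colv. Qed.

Lemma measurable_post_weight : measurable_fun [set: p.-tuple R] post_weight.
Proof.
apply: measurable_funM; last exact: measurable_gauss.
apply: measurable_prod => i _.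
apply: (measurableT_comp (measurable_half_line_mass (tnth y i))).
exact: measurable_linpred.
Qed.

Lemma likelihood_gt0 b : 0 < likelihood b.
Proof. by apply: prodr_gt0 => i _; exact: half_line_mass_gt0. Qed.

Lemma likelihood_le1 b : likelihood b <= 1.
Proof.
apply: prodr_ile1 => i _.
by rewrite half_line_mass_le1 ltW// half_line_mass_gt0.
Qed.

Lemma post_weight_gt0 b : 0 < post_weight b.
Proof. by rewrite mulr_gt0 ?likelihood_gt0// gauss_gt0. Qed.

Lemma post_weight_le b : post_weight b <= gauss Q v b.
Proof. by rewrite ler_piMl ?likelihood_le1// ltW// gauss_gt0. Qed.

Lemma post_weight_proper : proper_weight post_weight.
Proof.
have mE : measurable_fun [set: p.-tuple R] (fun b => (post_weight b)%:E).
  by apply/measurable_EFinP; exact: measurable_post_weight.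
split.
- exact: measurable_post_weight.
- by move=> b; exact/ltW/post_weight_gt0.
- apply: integral_gt0; [exact: measurableT|exact: mE| |exact: lebesgue_tuple_setT_neq0].
  by move=> b _; rewrite lte_fin post_weight_gt0.
- have [mg g0 _ goo] := gauss_proper v Qpd.
  apply: le_lt_trans goo; apply: ge0_le_integral.
  + exact: measurableT.
  + by move=> b _; rewrite lee_fin ltW// post_weight_gt0.
  + exact: mE.
  + exact/measurable_EFinP.
  + by move=> b _; rewrite lee_fin post_weight_le.
Qed.

(** The data augmentation density of the parameter b and the latent vector z,
    up to a constant factor. *)
Definition joint (b : p.-tuple R) (z : n.-tuple R) : R :=
  (\prod_(i < n) half_line_pdf (linpred X b i) (tnth y i) (tnth z i)) * gauss Q v b.

Lemma joint_ge0 b z : 0 <= joint b z.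
Proof.
rewrite mulr_ge0 ?(ltW (gauss_gt0 _ _ _))// prodr_ge0// => i _.
exact: half_line_pdf_ge0.
Qed.

Lemma measurable_joint :
  measurable_fun [set: p.-tuple R * n.-tuple R] (fun bz => joint bz.1 bz.2).
Proof.
apply: measurable_funM; last first.
  exact: (measurableT_comp (measurable_gauss Q v) measurable_fst).
apply: measurable_prod => i _.
have ml : measurable_fun [set: p.-tuple R * n.-tuple R]
    (fun bz => linpred X bz.1 i).
  exact: (measurableT_comp (measurable_linpred i) measurable_fst).
have mz : measurable_fun [set: p.-tuple R * n.-tuple R]
    (fun bz : p.-tuple R * n.-tuple R => tnth bz.2 i).
  exact: (measurableT_comp (measurable_tnth i) measurable_snd).
apply: measurable_funM.
  under eq_fun do rewrite normal_pdf1E.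
  apply: measurable_funM => //; apply: measurableT_comp => //.
  apply: measurableT_comp => //; apply: measurable_funM => //.
  by apply: measurable_funX; exact: measurable_funB.
have mI : measurable_fun [set: R] (\1_(half_line (tnth y i)) : R -> R).
  by apply: measurable_indic; exact: measurable_half_line.
exact: (measurableT_comp mI mz).
Qed.

(** Given b, the latent variables are truncated normal, and the marginal in b is
    the posterior weight: the normalising constants of the truncated laws cancel
    the likelihood. *)
Lemma ge0_integral_joint b (h : n.-tuple R -> \bar R) :
  measurable_fun [set: n.-tuple R] h -> (forall z, 0 <= h z)%E ->
  ((\int[tprod (latent_law X y b)]_z h z) * (post_weight b)%:E =
   \int[lamn]_z (h z * (joint b z)%:E))%E.
Proof.
move=> mh h0.
have mp i : measurable_fun [set: R]
    (fun x => half_line_pdf (linpred X b i) (tnth y i) x).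
  apply: measurable_funM; first exact: measurable_normal_pdf.
  by apply: measurable_indic; exact: measurable_half_line.
have c0 i := half_line_mass_gt0 (linpred X b i) (tnth y i).
rewrite (@ge0_integral_tprod_transform _ _ (fun=> leb) (latent_law X y b)
  (fun _ x => x) (fun i x => half_line_pdf (linpred X b i) (tnth y i) x /
                             half_line_mass (linpred X b i) (tnth y i))).
- have w0 (z : n.-tuple R) : 0 <= \prod_(i < n)
      (half_line_pdf (linpred X b i) (tnth y i) (tnth z i) /
       half_line_mass (linpred X b i) (tnth y i)).
    apply: prodr_ge0 => i _; apply: divr_ge0; first exact: half_line_pdf_ge0.
    exact: ltW.
  have idE (z : n.-tuple R) : coord_map (fun _ x => x) z = z.
    by apply: eq_from_tnth => i; rewrite tnth_mktuple.
  rewrite -ge0_integralZr; last 4 first.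
  + exact: measurableT.
  + apply: emeasurable_funM.
      apply: (measurableT_comp mh); apply: measurable_coord_map => i.
      exact: measurable_id.
    apply/measurable_EFinP; apply: (@measurable_prod_tnth R n (fun i x =>
      half_line_pdf (linpred X b i) (tnth y i) x /
      half_line_mass (linpred X b i) (tnth y i))).
    by move=> i; apply: measurable_funM => //; exact: mp.
  + by move=> z _; rewrite mule_ge0// lee_fin.
  + by rewrite lee_fin ltW// post_weight_gt0.
  apply: eq_integral => z _; rewrite idE -muleA -EFinM; congr (_ * _%:E)%E.
  rewrite /post_weight /joint mulrA; congr (_ * _).
  rewrite /likelihood -big_split/=; apply: eq_bigr => i _.
  by rewrite divfK// gt_eqF.
- by move=> i; exact: measurable_id.
- by move=> i; apply: measurable_funM => //; exact: mp.
- by move=> i x; apply: divr_ge0; [exact: half_line_pdf_ge0|exact: ltW].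
- by move=> i g mg g0; exact: ge0_integral_trunc_normal.
- exact: mh.
- exact: h0.
Qed.

(** Both sides are quadratic in b with leading form S, and the mean of z is the
    point where their linear terms agree. *)
Lemma complete_square (b : p.-tuple R) (z : n.-tuple R) :
  sqnorm (colv z - X *m colv b) + qform Q (colv b - v) =
  qform S (colv b - mean z) +
  (sqnorm (colv z) + qform Q v - qform S (mean z)).
Proof.
have [symQ _] := Qpd; have [symS _] := Spd.
have bm : bform S (colv b) (mean z) =
    bform 1%:M (X *m colv b) (colv z) + bform Q (colv b) v.
  rewrite bform_mulmx /post_mean mulKVmx ?posdef_unitmx// bformDr.
  by congr (_ + _); rewrite /bform ?trmx_mul !mulmx1 ?mulmxA.
have qS : qform S (colv b) = sqnorm (X *m colv b) + qform Q (colv b).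
  by rewrite qformE bformDS -!qformE -sqnorm_mulmx.
rewrite (qformB _ _ symS) (qformB _ _ symQ) bm qS /sqnorm.
rewrite (qformB _ _ (trmx1 _ _)) (bformC _ _ (trmx1 _ _)); ring.
Qed.

(** The factor of the joint density that depends on z only. *)
Definition joint_factor (z : n.-tuple R) : R :=
  (\prod_(i < n) (@normal_peak R 1 * \1_(half_line (tnth y i)) (tnth z i))) *
  expR (- (2^-1 * (sqnorm (colv z) + qform Q v - qform S (mean z)))).

Lemma joint_factor_ge0 z : 0 <= joint_factor z.
Proof.
rewrite mulr_ge0 ?expR_ge0// prodr_ge0// => i _.
by rewrite mulr_ge0// normal_peak_ge0.
Qed.

Lemma jointE b z : joint b z = joint_factor z * gauss S (mean z) b.
Proof.
rewrite /joint /joint_factor -mulrA /gauss -expRD.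
under eq_bigr do rewrite /half_line_pdf normal_pdf1E mulrAC.
rewrite big_split/= -mulrA -expR_sum -expRD; congr (_ * expR _).
rewrite sumrN -mulr_sumr -!opprD -!mulrDr; congr (- (_ * _)).
rewrite [RHS]addrC -complete_square; congr (_ + _).
rewrite sqnormE; apply: eq_bigr => i _.
by rewrite [in RHS]mxE [X in _ = (X + _) ^+ 2]mxE [X in _ = (_ + X) ^+ 2]mxE.
Qed.

(** Given z, the parameter has the law from which the chain draws it. The form
    without division covers the z for which the joint density vanishes. *)
Lemma multinormal_joint (A : set (p.-tuple R)) z : measurable A ->
  (multinormal (mean z) (invmx S) A * (\int[lamp]_b (joint b z)%:E) =
   \int[lamp]_b (joint b z * \1_A b)%:E)%E.
Proof.
move=> mA; have [mg g0 _ _] := gauss_proper (mean z) Spd.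
have gp := gauss_proper (mean z) Spd.
have mgE : measurable_fun [set: p.-tuple R] (EFin \o gauss S (mean z)).
  exact/measurable_EFinP.
have k0 := joint_factor_ge0 z.
have E1 : (\int[lamp]_b (joint b z)%:E =
    (joint_factor z)%:E * (weight_mass (gauss S (mean z)))%:E)%E.
  under eq_integral do rewrite jointE EFinM.
  rewrite (weight_massK gp) ge0_integralZl; first by [].
  - exact: measurableT.
  - exact: mgE.
  - by move=> b _; rewrite lee_fin.
  - by rewrite lee_fin.
have E2 : (\int[lamp]_b (joint b z * \1_A b)%:E =
    (joint_factor z)%:E * \int[lamp]_(b in A) (gauss S (mean z) b)%:E)%E.
  rewrite [in RHS]integral_mkcond -ge0_integralZl; last 4 first.
  - exact: measurableT.
  - by apply/(measurable_restrictT _ mA); exact: measurable_funTS.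
  - by move=> b _; rewrite patchE; case: ifPn => // _; rewrite lee_fin.
  - by rewrite lee_fin.
  apply: eq_integral => b _; rewrite jointE patchE indicE.
  by case: ifPn => _; rewrite ?mulr1 ?mulr0 ?mule0// EFinM.
rewrite E1 E2 multinormalE /density_prob -/(weight_mass _).
rewrite [(_%:E * (weight_mass _)%:E)%E]muleC muleA -[X in (X * _)%E]muleA -EFinM.
by rewrite mulVf ?mule1 ?gt_eqF ?weight_mass_gt0// muleC.
Qed.

Variable noise : probability (p.-tuple R) R.
Hypothesis noiseE : (noise : set (p.-tuple R) -> \bar R) = multinormal 0 (invmx S).

(** Integrate the joint density: drawing z given b, then a new parameter given
    z, leaves the law of the pair unchanged. Formally, Tonelli exchanges the
    integrals over b and z, so that the conditional law given z can be applied,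
    and exchanges them back. *)
Lemma posterior_invariant A : measurable A ->
  measurable_fun [set: p.-tuple R] (fun b => albert_chib X y Q v b A) ->
  (\int[posterior X y Q v]_b albert_chib X y Q v b A = posterior X y Q v A)%E.
Proof.
move=> mA mK; pose h z := multinormal (mean z) (invmx S) A.
have mh : measurable_fun [set: n.-tuple R] h := measurable_cond_law v noiseE mA.
have h0 z : (0 <= h z)%E := cond_law_ge0 v noiseE z mA.
have KE b : albert_chib X y Q v b A = (\int[tprod (latent_law X y b)]_z h z)%E by [].
have K0 b : (0 <= albert_chib X y Q v b A)%E.
  by rewrite KE; apply: integral_ge0 => z _.
rewrite posteriorE ge0_integral_density_prob//; last exact: post_weight_proper.
rewrite /density_prob -/(weight_mass _); congr (_ * _)%E.
have mj : measurable_fun [set: p.-tuple R * n.-tuple R]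
    (fun bz => (joint bz.1 bz.2)%:E).
  by apply/measurable_EFinP; exact: measurable_joint.
have mjA : measurable_fun [set: p.-tuple R * n.-tuple R]
    (fun bz => (joint bz.1 bz.2 * \1_A bz.1)%:E).
  apply/measurable_EFinP/measurable_funM; first exact: measurable_joint.
  by apply: (measurableT_comp (measurable_indic mA)).
transitivity (\int[lamp]_b \int[lamn]_z (h z * (joint b z)%:E))%E.
  by apply: eq_integral => b _; rewrite KE ge0_integral_joint.
rewrite (fubini_tonelli (m1 := lamp) (m2 := lamn)
  (fun bz => h bz.2 * (joint bz.1 bz.2)%:E)%E)/=; last 2 first.
- apply: emeasurable_funM; last exact: mj.
  exact: (measurableT_comp mh measurable_snd).
- by move=> bz; apply: mule_ge0; [exact: h0|rewrite lee_fin joint_ge0].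
transitivity (\int[lamn]_z \int[lamp]_b (joint b z * \1_A b)%:E)%E.
  apply: eq_integral => z _; rewrite -multinormal_joint//.
  rewrite -ge0_integralZl; first by [].
  - exact: measurableT.
  - exact: (measurableT_comp mj (pair2_measurable z)).
  - by move=> b _; rewrite lee_fin joint_ge0.
  - exact: h0.
have jA0 bz : (0 <= (joint bz.1 bz.2 * \1_A bz.1)%:E)%E.
  by rewrite lee_fin mulr_ge0// joint_ge0.
transitivity (\int[lamp]_b \int[lamn]_z (joint b z * \1_A b)%:E)%E.
  exact: (esym (fubini_tonelli (m1 := lamp) (m2 := lamn) _ mjA jA0)).
rewrite [RHS]integral_mkcond; apply: eq_integral => b _.
rewrite patchE indicE; case: ifPn => _.
  under eq_integral do rewrite mulr1 -[X in X%:E]mul1r EFinM.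
  rewrite -(@ge0_integral_joint b (cst 1%E)).
  - rewrite integral_cst// mul1e.
    rewrite [X in (X * _)%E](_ : _ = 1%E); first by rewrite mul1e.
    apply: tprod_setT => i.
    exact: (@probability_setT _ _ _ (trunc_normal (linpred X b i) (tnth y i))).
  - exact: measurable_cst.
  - by move=> z.
by under eq_integral do rewrite mulr0; rewrite integral0.
Qed.

Lemma measurable_psi :
  measurable_fun [set: p.-tuple R * p.-tuple R] (fun u => psi X Q u.1 u.2).
Proof.
have msqrt : measurable_fun [set: R] (@Num.sqrt R).
  apply: nondecreasing_measurable; first exact: measurableT.
  by move=> s t; exact: ler_wsqrtr.
apply: (measurableT_comp msqrt).
have mt i : measurable_fun [set: p.-tuple R * p.-tuple R]
    (fun u => (colv u.1 - colv u.2) i ord0).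
  under eq_fun do rewrite !mxE.
  apply: measurable_funB.
    exact: (measurableT_comp (measurable_tnth i) measurable_fst).
  exact: (measurableT_comp (measurable_tnth i) measurable_snd).
under eq_fun do rewrite qform_sum.
apply: measurable_sum => i; apply: measurable_sum => j.
by apply: measurable_funM => //; exact: measurable_funM.
Qed.

(** psi <= 1 + psi^2 is at most a quadratic polynomial in the parameter, and the
    posterior density is at most the Gaussian prior weight up to a constant. *)
Lemma posterior_psi_lty b : (\int[posterior X y Q v]_x (psi X Q b x)%:E < +oo)%E.
Proof.
have [symS _] := Spd; have S0 u : 0 <= qform S u by exact: posdef_ge0.
have mpsi : measurable_fun [set: p.-tuple R] (fun x => (psi X Q b x)%:E).
  by apply/measurable_EFinP; exact: (measurableT_comp measurable_psi (pair1_measurable b)).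
have psi0 x : (0 <= (psi X Q b x)%:E)%E by rewrite lee_fin sqrtr_ge0.
have wp := post_weight_proper.
rewrite posteriorE ge0_integral_density_prob; [|exact: wp|exact: mpsi|exact: psi0].
have [mg g0 _ goo] := gauss_proper v Qpd.
have moo := gauss_moment_lty v Qpd S0.
have mmom : measurable_fun [set: p.-tuple R]
    (fun x => (qform S (colv x - v) * gauss Q v x)%:E).
  by apply/measurable_EFinP/measurable_funM => //; exact: measurable_qform_colv.
have mgE : measurable_fun [set: p.-tuple R] (fun x => (gauss Q v x)%:E).
  exact/measurable_EFinP.
pose k := 1 + 2 * qform S (colv b - v).
have k0 : 0 <= k by rewrite addr_ge0// mulr_ge0.
have pg0 x : (0 <= (psi X Q b x)%:E * (post_weight x)%:E)%E.
  by apply: mule_ge0 => //; rewrite lee_fin ltW// post_weight_gt0.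
have mom0 x : (0 <= (qform S (colv x - v) * gauss Q v x)%:E)%E.
  by rewrite lee_fin mulr_ge0.
have pointwise x : psi X Q b x * post_weight x <=
    k * gauss Q v x + 2 * (qform S (colv x - v) * gauss Q v x).
  rewrite mulrA -mulrDl; apply: ler_pM; rewrite ?sqrtr_ge0 ?post_weight_le//.
    exact/ltW/post_weight_gt0.
  have -> : psi X Q b x = Num.sqrt (qform S ((colv b - v) - (colv x - v))).
    by rewrite /psi opprB addrA subrK.
  have -> : k + 2 * qform S (colv x - v) =
      1 + 2 * (qform S (colv b - v) + qform S (colv x - v)).
    by rewrite /k mulrDr addrA.
  move: (colv b - v) (colv x - v) => u w.
  have h1 := S0 (u + w); have h2 := S0 (u - w).
  rewrite qformD// in h1; have h3 := sqr_sqrtr h2.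
  set s := Num.sqrt _ in h3 *; have := sqr_ge0 (s - 1).
  rewrite qformB// in h3; nra.
have fin : (\int[lamp]_x ((psi X Q b x)%:E * (post_weight x)%:E) < +oo)%E.
  apply: (@le_lt_trans _ _ (\int[lamp]_x (k%:E * (gauss Q v x)%:E +
      2%:E * (qform S (colv x - v) * gauss Q v x)%:E))%E).
    apply: ge0_le_integral.
    - exact: measurableT.
    - by move=> x _; exact: pg0.
    - apply: emeasurable_funM; first exact: mpsi.
      by apply/measurable_EFinP; exact: measurable_post_weight.
    - apply: emeasurable_funD.
        by apply: emeasurable_funM; [exact: measurable_cst|exact: mgE].
      by apply: emeasurable_funM; [exact: measurable_cst|exact: mmom].
    - by move=> x _; rewrite -!EFinM -EFinD lee_fin.
  rewrite ge0_integralD; first last.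
  - by apply: emeasurable_funM; [exact: measurable_cst|exact: mmom].
  - by move=> x _; apply: mule_ge0; [rewrite lee_fin|exact: mom0].
  - by apply: emeasurable_funM; [exact: measurable_cst|exact: mgE].
  - by move=> x _; apply: mule_ge0; rewrite lee_fin.
  - exact: measurableT.
  rewrite ge0_integralZl; [|exact: measurableT|exact: mgE
    |by move=> x _; rewrite lee_fin|by rewrite lee_fin].
  rewrite ge0_integralZl; [|exact: measurableT|exact: mmom
    |by move=> x _; exact: mom0|by rewrite lee_fin].
  apply: lte_add_pinfty; apply: lte_mul_pinfty; rewrite ?lee_fin//.
apply: lte_mul_pinfty; last exact: ltry.
  by apply: integral_ge0 => x _; exact: pg0.
by rewrite ge0_fin_numE ?fin//; apply: integral_ge0 => x _; exact: pg0.
Qed.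

End invariance.

(** * The uniform rate *)

Section uniform_rate.
Context {R : realType} {p n : nat}.
Variables (X : 'M[R]_(n, p)) (y : n.-tuple bool).
Variables (Q : 'M[R]_p) (v : 'cV[R]_p) (l : R).
Hypothesis Qpd : posdef Q.
Hypothesis l0 : 0 < l.
Hypothesis Xl : forall s, qform (X *m invmx Q *m X^T) s <= l * sqnorm s.

Lemma albert_chib_rates :
  rho_star_psi X y Q v <= rate l /\ rho_star_TV X y Q v <= rate l.
Proof.
have [Pi PiE] := density_probability (post_weight_proper X y v Qpd).
have [noise noiseE] := density_probability (gauss_proper 0 (posdef_Sigma X Qpd)).
have nE : (noise : set (p.-tuple R) -> \bar R) = multinormal 0 (invmx (Sigma X Q)).
  by rewrite noiseE; apply/funext => A; rewrite multinormalE.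
have uT : tprod (unifs : 'I_n -> {sigma_finite_measure set R -> \bar R})
    [set: n.-tuple R] = 1%E.
  by apply: tprod_setT => i; exact: (@probability_setT _ _ _ unif01).
pose pr := Measure_isProbability.Build _ _ _ (tprod unifs) uT.
pose unif : probability (n.-tuple R) R := HB.pack (tprod (@unifs R n)) pr.
have unifE : (unif : set (n.-tuple R) -> \bar R) = tprod unifs by [].
have r0 := rate_gt0 l0; have r1 := rate_lt1 l0.
pose P := [the probability (n.-tuple R * p.-tuple R)%type R of (unif \x noise)%E].
have KE b A : measurable A -> albert_chib X y Q v b A =
    P [set w | chain_map X y Q v (b, w) \in A].
  by move=> mA; exact: (albert_chib_random_map y v nE b unifE mA).
have mF := measurable_chain_map X y Q v.
have inv A : measurable A -> (\int[Pi]_b albert_chib X y Q v b A = Pi A)%E.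
  move=> mA; have := posterior_invariant Qpd nE mA (measurable_step mF KE mA).
  by rewrite posteriorE -PiE.
have fin b : (\int[Pi]_x (psi X Q b x)%:E < +oo)%E.
  by have := posterior_psi_lty X y v Qpd b; rewrite posteriorE -PiE.
have psi0 b b' : 0 <= psi X Q b b' by exact: sqrtr_ge0.
have contract := chain_map_contract y v Qpd l0 Xl.
rewrite /rho_star_psi /rho_star_TV posteriorE -PiE; split.
  exact: (wasserstein_rate mF KE inv (measurable_psi X Q) psi0 (ltW r0) contract
    fin (ltW r1)).
apply: (total_variation_rate mF KE inv (measurable_psi X Q) psi0 (ltW r0) contract
    fin (ltW r1) (C := 3 * rate l) r0).
- by rewrite mulr_ge0// ltW.
- by move=> b b' A mA; exact: (albert_chib_smooth y v Qpd nE l0 Xl b b' unifE mA).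
- by move=> b b'; rewrite /psi -qformN opprB.
Qed.

End uniform_rate.
Theorem proposition22 (R : realType)
  (X : forall p n : nat, 'M[R]_(n, p))
  (y : forall p n : nat, n.-tuple bool)
  (Q : forall p n : nat, 'M[R]_p)
  (v : forall p n : nat, 'cV[R]_p)
  (C1 : forall p n : nat, (0 < p)%N -> (0 < n)%N -> posdef (Q p n))
  (C2 : exists ell : R, forall p n : nat, (0 < p)%N -> (0 < n)%N ->
    lambda_max (X p n *m invmx (Q p n) *m (X p n)^T) <= ell) :
  (exists rho : R, rho < 1 /\
     forall p n : nat, (0 < p)%N -> (0 < n)%N ->
       rho_star_psi (X p n) (y p n) (Q p n) (v p n) <= rho) /\
  (exists rho : R, rho < 1 /\
     forall p n : nat, (0 < p)%N -> (0 < n)%N ->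
       rho_star_TV (X p n) (y p n) (Q p n) (v p n) <= rho).
Proof.
have [ell Hell] := C2; pose l := Num.max ell 1.
have l0 : 0 < l by rewrite lt_max ltr01 orbT.
have rates p n (p0 : (0 < p)%N) (n0 : (0 < n)%N) :
    rho_star_psi (X p n) (y p n) (Q p n) (v p n) <= rate l /\
    rho_star_TV (X p n) (y p n) (Q p n) (v p n) <= rate l.
  have Qpd := C1 p n p0 n0; apply: albert_chib_rates => // s.
  have sym : (X p n *m invmx (Q p n) *m (X p n)^T)^T =
      X p n *m invmx (Q p n) *m (X p n)^T.
    by rewrite !trmx_mul trmxK trmx_inv Qpd.1 mulmxA.
  apply: (le_trans (rayleigh n0 sym s)); apply: ler_wpM2r; first exact: sqnorm_ge0.
  by rewrite le_max Hell.
by split; exists (rate l); split=> [|p n p0 n0]; rewrite ?rate_lt1//;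
  have [] := rates p n p0 n0.
Qed.
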